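(* Let $A$ be a cellular algebra over a commutative ring $R$, with cell datum $(\Lambda, M, C, * )$. Let $Y \subset X$ be downward closed subsets of $\Lambda$, with $X \setminus Y$ finite. Suppose that for each $\lambda \in X \setminus Y$ the following holds: for every $q \in M(\lambda)$ there exists $v \in W(\lambda)$ such that $\phi_\lambda(C_q, v) = 1$. Then, for any right $A$-module $P$ and any left $A$-module $N$ such that $I_X$ acts trivially (i.e. by zero) on both, we have $$\mathrm{Tor}_*^{A/I_{Y}}(P,N) \cong \mathrm{Tor}_*^{A/I_{X}}(P,N).$$
   Context: $R$ is a commutative ring with unit. A cellular algebra (Graham–Lehrer) over $R$ is an associative unital $R$-algebra $A$ with cell datum $(\Lambda,M,C,* )$, where: (C1) $\Lambda$ is a poset and, for each $\lambda\in\Lambda$, $M(\lambda)$ is a finite set such that $\coprod_{\lambda} M(\lambda)\times M(\lambda)\to A$, $(S,T)\mapsto C_{S,T}^{\lambda}$, is injective with image an $R$-basis of $A$. (C2) $*$ is an $R$-linear anti-involution of $A$ with $(C_{S,T}^{\lambda})^*=C_{T,S}^{\lambda}$. (C3) For $\lambda\in\Lambda$, $S,T\in M(\lambda)$, $a\in A$: $aC_{S,T}^{\lambda}\equiv\sum_{S'\in M(\lambda)} r_a(S',S)C_{S',T}^{\lambda}\pmod{A(<\lambda)}$, where $r_a(S',S)\in R$ is independent of $T$ and $A(<\lambda)$ is the $R$-span of the $C_{U,V}^{\mu}$ with $\mu<\lambda$, $U,V\in M(\mu)$. A subset $X\subset\Lambda$ is downward closed if $\mu\le\lambda$ and $\lambda\in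 X$ imply $\mu\in X$. $I_X$ is the $R$-span of the $C_{S,T}^{\mu}$ with $\mu\in X$, $S,T\in M(\mu)$; it is a two-sided ideal when $X$ is downward closed. The cell module $W(\lambda)$ is the free $R$-module on symbols $C_S$, $S\in M(\lambda)$, with $aC_S=\sum_{S'\in M(\lambda)} r_a(S',S)C_{S'}$. The bilinear form $\phi_\lambda$ on $W(\lambda)$ is the $R$-bilinear form for which $\phi_\lambda(C_T,C_S)$ is the coefficient of $C_{S_1,T_2}^{\lambda}$ in the product $C_{S_1,T}^{\lambda}C_{S,T_2}^{\lambda}$, for any $S_1,T_2\in M(\lambda)$ (the result is independent of $S_1,T_2$). Since $I_Y\subset I_X$ acts trivially, $P$ and $N$ are modules over $A/I_Y$ and over $A/I_X$. *)

(* Defs.v *)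
From HB Require Import structures.
From mathcomp Require Import all_boot all_order all_algebra.
From mathcomp Require Import finmap boolp classical_sets cardinality.

Set Implicit Arguments.
Unset Strict Implicit.
Unset Printing Implicit Defensive.

Import Order.TTheory GRing.Theory.

Local Open Scope fset_scope.
Local Open Scope quotient_scope.
Local Open Scope ring_scope.

(* Unital associative R-algebras, with R and the algebra possibly zero. The   *)
(* library's algType R excludes the zero ring, but quotients A / I may vanish.*)
(* The R-action is r . x = ralg r * x.                                        *)
HB.mixin Record hasCentralMap (R : comPzRingType) A of GRing.PzRing A := {
  ralg : {rmorphism R -> A};
  ralgC : forall (r : R) (x : A), ralg r * x = x * ralg r
}.

#[short(type="ralgType")]
HB.structure Definition RAlgebra (R : comPzRingType) :=
  {A of GRing.PzRing A & hasCentralMap R A}.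

Section FreeModule.
Variables (B : pzRingType) (K : choiceType).

Definition free : Type := {fsfun K -> B with 0}.
HB.instance Definition _ := Choice.on free.
Identity Coercion fsfun_of_free : free >-> fsfun.

Implicit Types f g : free.

Definition free_zero : free := [fsfun].
Definition free_opp f : free := [fsfun k in finsupp f => - f k].
Definition free_add f g : free :=
  [fsfun k in finsupp f `|` finsupp g => f k + g k].
Definition free_scale (b : B) f : free := [fsfun k in finsupp f => b * f k].
Definition free_gen (k : K) : free := [fsfun j in [fset k] => 1].

Lemma free_zeroE k : free_zero k = 0.
Proof. by rewrite fsfun0E. Qed.
Lemma free_oppE f k : free_opp f k = - f k.
Proof. by rewrite fsfun_fun; case: finsuppP; rewrite ?oppr0. Qed.
Lemma free_addE f g k : free_add f g k = f k + g k.
Proof.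
rewrite fsfun_fun in_fsetU.
by case: (finsuppP f k); case: (finsuppP g k); rewrite ?addr0.
Qed.
Lemma free_scaleE b f k : free_scale b f k = b * f k.
Proof. by rewrite fsfun_fun; case: finsuppP; rewrite ?mulr0. Qed.

Let addA : associative free_add.
Proof. by move=> f g h; apply/fsfunP => k; rewrite !free_addE addrA. Qed.
Let addC : commutative free_add.
Proof. by move=> f g; apply/fsfunP => k; rewrite !free_addE addrC. Qed.
Let add0 : left_id free_zero free_add.
Proof. by move=> f; apply/fsfunP => k; rewrite free_addE free_zeroE add0r. Qed.
Let addN : left_inverse free_zero free_opp free_add.
Proof.
by move=> f; apply/fsfunP => k; rewrite free_addE free_oppE free_zeroE addNr.
Qed.
HB.instance Definition _ := GRing.isZmodule.Build free addA addC add0 addN.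

Lemma freeD f g k : (f + g : free) k = f k + g k.
Proof. exact: free_addE. Qed.
Lemma freeN f k : (- f : free) k = - f k.
Proof. exact: free_oppE. Qed.
Lemma free0 k : (0 : free) k = 0.
Proof. exact: free_zeroE. Qed.

Let scaleA b c f : free_scale b (free_scale c f) = free_scale (b * c) f.
Proof. by apply/fsfunP => k; rewrite !free_scaleE mulrA. Qed.
Let scale1 : left_id 1 free_scale.
Proof. by move=> f; apply/fsfunP => k; rewrite free_scaleE mul1r. Qed.
Let scaleDr : right_distributive free_scale +%R.
Proof.
by move=> b f g; apply/fsfunP => k; rewrite !(free_scaleE, freeD) mulrDr.
Qed.
Let scaleDl f : {morph free_scale^~ f : b c / b + c}.
Proof.
by move=> b c; apply/fsfunP => k; rewrite !(free_scaleE, freeD) mulrDl.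
Qed.
HB.instance Definition _ :=
  GRing.Zmodule_isLmodule.Build B free scaleA scale1 scaleDr scaleDl.

Lemma freeZ b f k : (b *: f : free) k = b * f k.
Proof. exact: free_scaleE. Qed.

Lemma free_genE k j : free_gen k j = (j == k)%:R.
Proof. by rewrite fsfun_fun in_fset1; case: eqP. Qed.

Section Sum.
Variables (V : zmodType) (F : K -> B -> V).
Hypothesis F0 : forall k, F k 0 = 0.

Lemma free_sum_widen f (S : {fset K}) : finsupp f `<=` S ->
  \sum_(k <- finsupp f) F k (f k) = \sum_(k <- S) F k (f k).
Proof.
move=> fS; apply: (big_fset_incl +%R fS) => k _ kf.
by rewrite fsfun_dflt.
Qed.

Lemma free_sum_gen k : \sum_(j <- finsupp (free_gen k)) F j (free_gen k j) = F k 1.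
Proof.
have kS : finsupp (free_gen k) `<=` [fset k].
  apply/fsubsetP => j; rewrite mem_finsupp free_genE in_fset1.
  by case: (j =P k); rewrite ?eqxx.
by rewrite (free_sum_widen kS) big_seq_fset1 free_genE eqxx.
Qed.

Hypothesis FD : forall k b c, F k (b + c) = F k b + F k c.

Lemma free_sumD f g :
  \sum_(k <- finsupp (f + g)) F k ((f + g) k) =
  \sum_(k <- finsupp f) F k (f k) + \sum_(k <- finsupp g) F k (g k).
Proof.
pose S := finsupp f `|` finsupp g.
have fgS : finsupp (f + g) `<=` S.
  apply/fsubsetP => k; rewrite in_fsetU !mem_finsupp freeD.
  apply: contraR; rewrite negb_or !negbK => /andP[/eqP-> /eqP->].
  by rewrite addr0.
rewrite (free_sum_widen fgS) (free_sum_widen (fsubsetUl _ _ : _ `<=` S)).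
rewrite (free_sum_widen (fsubsetUr _ _ : _ `<=` S)).
by rewrite -big_split /=; apply: eq_bigr => k _; rewrite freeD FD.
Qed.

End Sum.

Section Lift.
Variables (V : lmodType B) (h : K -> V).

Definition free_lift f : V := \sum_(k <- finsupp f) f k *: h k.

Lemma free_lift_linear : linear free_lift.
Proof.
move=> b f g; rewrite /free_lift.
pose F k c := c *: h k.
have F0 k : F k 0 = 0 by rewrite /F scale0r.
have FD k c c' : F k (c + c') = F k c + F k c' by rewrite /F scalerDl.
rewrite (free_sumD F0 FD); congr (_ + _).
have fS : finsupp (b *: f) `<=` finsupp f.
  apply/fsubsetP => k; rewrite !mem_finsupp freeZ.
  by apply: contraNN => /eqP->; rewrite mulr0.
by rewrite (free_sum_widen F0 fS) scaler_sumr; apply: eq_bigr => k _; rewrite /F freeZ scalerA.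
Qed.
HB.instance Definition _ :=
  GRing.isLinear.Build B free V *:%R free_lift free_lift_linear.

Lemma free_lift_gen k : free_lift (free_gen k) = h k.
Proof.
rewrite /free_lift (@free_sum_gen _ (fun k c => c *: h k)) ?scale1r // => j.
by rewrite scale0r.
Qed.

End Lift.
End FreeModule.

Record subgroup (V : zmodType) := Subgroup {
  subgroup_pred :> V -> Prop;
  subgroup0 : subgroup_pred 0;
  subgroupB : forall x y,
    subgroup_pred x -> subgroup_pred y -> subgroup_pred (x - y)
}.

Record submodule (B : pzRingType) (V : lmodType B) := Submodule {
  submodule_subgroup :> subgroup V;
  submoduleZ : forall b x, submodule_subgroup x -> submodule_subgroup (b *: x)
}.

Record ideal (A : pzRingType) := Ideal {
  ideal_subgroup :> subgroup A;
  idealMl : forall a x, ideal_subgroup x -> ideal_subgroup (a * x);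
  idealMr : forall a x, ideal_subgroup x -> ideal_subgroup (x * a)
}.

Section Quotient.
Variables (V : zmodType) (U : subgroup V).

Lemma subgroupN x : U x -> U (- x).
Proof. by move=> Ux; rewrite -sub0r; apply: subgroupB => //; apply: subgroup0. Qed.
Lemma subgroupD x y : U x -> U y -> U (x + y).
Proof. by move=> Ux Uy; rewrite -[y]opprK; apply/subgroupB/subgroupN. Qed.

Definition quot_rel : rel V := fun x y => `[< U (x - y) >].

Let quot_refl : reflexive quot_rel.
Proof. by move=> x; apply/asboolP; rewrite subrr; apply: subgroup0. Qed.
Let quot_sym : symmetric quot_rel.
Proof.
move=> x y; apply/asboolP/asboolP => /subgroupN; by rewrite opprB.
Qed.
Let quot_trans : transitive quot_rel.
Proof.
move=> y x z /asboolP Uxy /asboolP Uyz; apply/asboolP.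
by rewrite -(subrKA y x (- z)); apply: subgroupD.
Qed.
Canonical quot_equiv := EquivRel quot_rel quot_refl quot_sym quot_trans.

Definition quot : Type := {eq_quot quot_equiv}.
HB.instance Definition _ := Choice.on quot.
HB.instance Definition _ := EqQuotient.on quot.

Definition qpi (x : V) : quot := \pi_quot x.
Definition qrepr (q : quot) : V := repr q.

Lemma qreprK q : qpi (qrepr q) = q.
Proof. exact: reprK. Qed.
Lemma eq_qpi x y : qpi x = qpi y <-> U (x - y).
Proof.
split=> [/eqquotP /asboolP //|Uxy].
by apply/eqquotP/asboolP.
Qed.
Lemma qreprP x : U (qrepr (qpi x) - x).
Proof. by apply/eq_qpi; rewrite qreprK. Qed.

Definition quot_add (p q : quot) : quot := qpi (qrepr p + qrepr q).
Definition quot_opp (p : quot) : quot := qpi (- qrepr p).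

Lemma quot_addE x y : quot_add (qpi x) (qpi y) = qpi (x + y).
Proof.
apply/eq_qpi; rewrite opprD addrACA.
by apply: subgroupD; apply: qreprP.
Qed.
Lemma quot_oppE x : quot_opp (qpi x) = qpi (- x).
Proof. by apply/eq_qpi; rewrite -opprD; apply/subgroupN/qreprP. Qed.

Let addA : associative quot_add.
Proof.
move=> p q r; rewrite -(qreprK p) -(qreprK q) -(qreprK r).
by rewrite !quot_addE addrA.
Qed.
Let addC : commutative quot_add.
Proof. by move=> p q; rewrite /quot_add addrC. Qed.
Let add0 : left_id (qpi 0) quot_add.
Proof. by move=> p; rewrite -(qreprK p) quot_addE add0r. Qed.
Let addN : left_inverse (qpi 0) quot_opp quot_add.
Proof. by move=> p; rewrite -(qreprK p) quot_oppE quot_addE addNr. Qed.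
HB.instance Definition _ := GRing.isZmodule.Build quot addA addC add0 addN.

Lemma qpiD x y : qpi (x + y) = qpi x + qpi y.
Proof. by rewrite -quot_addE. Qed.
Lemma qpiN x : qpi (- x) = - qpi x.
Proof. by rewrite -quot_oppE. Qed.
Lemma qpi_is_zmod_morphism : zmod_morphism qpi.
Proof. by move=> x y; rewrite qpiD qpiN. Qed.
HB.instance Definition _ :=
  GRing.isZmodMorphism.Build V quot qpi qpi_is_zmod_morphism.
End Quotient.

Section QuotientModule.
Variables (B : pzRingType) (V : lmodType B) (U : submodule V).

Definition qmod : Type := quot U.
HB.instance Definition _ := GRing.Zmodule.on qmod.
Definition mpi (x : V) : qmod := qpi U x.
Definition mrepr (q : qmod) : V := qrepr q.

Definition qmod_scale (b : B) (q : qmod) : qmod := mpi (b *: mrepr q).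

Lemma qmod_scaleE b x : qmod_scale b (mpi x) = mpi (b *: x).
Proof. by apply/eq_qpi; rewrite -scalerBr; apply/submoduleZ/qreprP. Qed.

Lemma mreprK q : mpi (mrepr q) = q.
Proof. exact: qreprK. Qed.

Let scaleA b c q : qmod_scale b (qmod_scale c q) = qmod_scale (b * c) q.
Proof. by rewrite -(mreprK q) !qmod_scaleE scalerA. Qed.
Let scale1 : left_id 1 qmod_scale.
Proof. by move=> q; rewrite -(mreprK q) qmod_scaleE scale1r. Qed.
Let scaleDr : right_distributive qmod_scale +%R.
Proof.
move=> b p q; rewrite -(mreprK p) -(mreprK q) -[mpi _ + _]qpiD.
by rewrite !qmod_scaleE scalerDr [mpi _]qpiD.
Qed.
Let scaleDl q : {morph qmod_scale^~ q : b c / b + c}.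
Proof.
by move=> b c; rewrite -(mreprK q) !qmod_scaleE scalerDl [mpi _]qpiD.
Qed.
HB.instance Definition _ :=
  GRing.Zmodule_isLmodule.Build B qmod scaleA scale1 scaleDr scaleDl.

Lemma mpi_linear : linear mpi.
Proof. by move=> b x y; rewrite [LHS]qpiD; congr (_ + _); rewrite -[LHS]qmod_scaleE. Qed.
HB.instance Definition _ := GRing.isLinear.Build B V qmod *:%R mpi mpi_linear.

Lemma mpi_eq0 x : mpi x = 0 <-> U x.
Proof. by rewrite -[0](raddf0 mpi) -[X in _ <-> U X]subr0; apply: eq_qpi. Qed.

Section Lift.
Variables (W : lmodType B) (f : {linear V -> W}).
Hypothesis fU : forall x, U x -> f x = 0.

Definition qmod_lift (_ : forall x, U x -> f x = 0) (q : qmod) : W :=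
  f (mrepr q).

Lemma qmod_liftE x : qmod_lift fU (mpi x) = f x.
Proof.
apply/eqP; rewrite /qmod_lift -subr_eq0 -(raddfB f).
by apply/eqP/fU/qreprP.
Qed.

Lemma qmod_lift_linear : linear (qmod_lift fU).
Proof.
move=> b p q; rewrite -(mreprK p) -(mreprK q) -linearP !qmod_liftE.
exact: linearP.
Qed.
HB.instance Definition _ :=
  GRing.isLinear.Build B qmod W *:%R (qmod_lift fU) qmod_lift_linear.
End Lift.
End QuotientModule.

Section Span.
Variables (B : pzRingType) (V : lmodType B) (S : V -> Prop).

Definition span_pred (x : V) : Prop :=
  forall U : submodule V, (forall s, S s -> U s) -> U x.

Let span0 : span_pred 0.
Proof. by move=> U _; apply: subgroup0. Qed.
Let spanB x y : span_pred x -> span_pred y -> span_pred (x - y).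
Proof. by move=> Sx Sy U SU; apply: subgroupB; [apply: Sx|apply: Sy]. Qed.
Let spanZ b x : @Subgroup V _ span0 spanB x -> @Subgroup V _ span0 spanB (b *: x).
Proof. by move=> Sx U SU; apply: submoduleZ; apply: Sx. Qed.
Definition span : submodule V := Submodule spanZ.

Lemma span_gen s : S s -> span s.
Proof. by move=> Ss U; apply. Qed.
End Span.

Section KernelImage.
Variables (B : pzRingType) (V W : lmodType B) (f : {linear V -> W}).

Definition ker_pred : {pred V} := [pred x | f x == 0].

Lemma ker_submod_closed : submod_closed ker_pred.
Proof.
split=> [|b x y]; first by rewrite inE raddf0.
by rewrite !inE => /eqP fx /eqP fy; rewrite linearP fx fy scaler0 addr0.
Qed.
HB.instance Definition _ := GRing.isSubmodClosed.Build B V ker_pred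
  (ker_submod_closed).

Definition ker : Type := {x : V | x \in ker_pred}.
HB.instance Definition _ := SubChoice.on ker.
HB.instance Definition _ := [SubChoice_isSubLmodule of ker by <:].

Definition ker_val (x : ker) : V := val x.
Lemma ker_val_linear : linear ker_val.
Proof. by move=> b x y; rewrite /ker_val linearP. Qed.
HB.instance Definition _ := GRing.isLinear.Build B ker V *:%R ker_val ker_val_linear.

End KernelImage.

(* ker g / (im f \cap ker g) for maps f : U -> V and g : V -> W; in a complex,*)
(* where im f is contained in ker g, this is the homology at V.               *)
Section Homology.
Variables (B : pzRingType) (U V W : lmodType B).
Variables (f : {linear U -> V}) (g : {linear V -> W}).

Let bound_pred (x : ker g) : Prop := exists u, f u = ker_val x.
Let bound0 : bound_pred 0.
Proof. by exists 0; rewrite !raddf0. Qed.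
Let boundB x y : bound_pred x -> bound_pred y -> bound_pred (x - y).
Proof. by move=> [u fu] [v fv]; exists (u - v); rewrite linearB fu fv linearB. Qed.
Let boundZ b x : @Subgroup _ _ bound0 boundB x -> @Subgroup _ _ bound0 boundB (b *: x).
Proof. by move=> [u fu]; exists (b *: u); rewrite linearZ fu linearZ. Qed.
Definition boundaries : submodule (ker g) := Submodule boundZ.

Definition homology : lmodType B := qmod boundaries.
End Homology.

Section QuotientRing.
Variables (A : pzRingType) (I : ideal A).

Definition qring : Type := quot I.
HB.instance Definition _ := GRing.Zmodule.on qring.
Definition rpi (x : A) : qring := qpi I x.
Definition rrepr (q : qring) : A := qrepr q.

Lemma rreprK q : rpi (rrepr q) = q.
Proof. exact: qreprK. Qed.
Lemma rreprP x : I (rrepr (rpi x) - x).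
Proof. exact: qreprP. Qed.

Definition qring_mul (p q : qring) : qring := rpi (rrepr p * rrepr q).

Lemma qring_mulE x y : qring_mul (rpi x) (rpi y) = rpi (x * y).
Proof.
apply/eq_qpi; set x' := rrepr _; set y' := rrepr _.
have -> : x' * y' - x * y = (x' - x) * y' + x * (y' - y).
  by rewrite mulrBl mulrBr subrKA.
by apply: subgroupD; [apply: idealMr|apply: idealMl]; apply: rreprP.
Qed.

Let mulA : associative qring_mul.
Proof.
move=> p q r; rewrite -(rreprK p) -(rreprK q) -(rreprK r).
by rewrite !qring_mulE mulrA.
Qed.
Let mul1 : left_id (rpi 1) qring_mul.
Proof. by move=> p; rewrite -(rreprK p) qring_mulE mul1r. Qed.
Let mulr1 : right_id (rpi 1) qring_mul.
Proof. by move=> p; rewrite -(rreprK p) qring_mulE mulr1. Qed.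
Let mulDl : left_distributive qring_mul +%R.
Proof.
move=> p q r; rewrite -(rreprK p) -(rreprK q) -(rreprK r).
by rewrite -[_ + _]qpiD !qring_mulE mulrDl [LHS]qpiD.
Qed.
Let mulDr : right_distributive qring_mul +%R.
Proof.
move=> p q r; rewrite -(rreprK p) -(rreprK q) -(rreprK r).
by rewrite -[rpi _ + _]qpiD !qring_mulE mulrDr [LHS]qpiD.
Qed.
HB.instance Definition _ :=
  GRing.Zmodule_isPzRing.Build qring mulA mul1 mulr1 mulDl mulDr.

Lemma rpiM x y : rpi (x * y) = rpi x * rpi y.
Proof. by symmetry; apply: qring_mulE. Qed.
Lemma rpi_zmod : zmod_morphism rpi.
Proof. exact: qpi_is_zmod_morphism. Qed.
Lemma rpi_monoid : monoid_morphism rpi.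
Proof. by split=> // x y; apply: rpiM. Qed.
HB.instance Definition _ := GRing.isZmodMorphism.Build A qring rpi rpi_zmod.
HB.instance Definition _ := GRing.isMonoidMorphism.Build A qring rpi rpi_monoid.

(* An A-module (resp. a right A-module) killed by I, as an A / I-module.      *)
Section Left.
Variable N : lmodType A.

Definition kills : Prop := forall a (x : N), I a -> a *: x = 0.

Definition descend of kills : Type := N.

Variable NI : kills.
HB.instance Definition _ := GRing.Zmodule.copy (descend NI) N.

Definition descend_scale (q : qring) (x : descend NI) : descend NI :=
  rrepr q *: (x : N).

Lemma descend_scaleE a x : descend_scale (rpi a) x = a *: (x : N).
Proof.
by apply/eqP; rewrite -subr_eq0 -scalerBl; apply/eqP/NI/rreprP.
Qed.

Let scaleA p q x : descend_scale p (descend_scale q x) = descend_scale (p * q) x.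
Proof.
by rewrite -(rreprK p) -(rreprK q) -rpiM !descend_scaleE scalerA.
Qed.
Let scale1 : left_id 1 descend_scale.
Proof. by move=> x; rewrite -[1]/(rpi 1) descend_scaleE scale1r. Qed.
Let scaleDr : right_distributive descend_scale +%R.
Proof. by move=> q x y; apply: scalerDr. Qed.
Let scaleDl x : {morph descend_scale^~ x : p q / p + q}.
Proof.
move=> p q; rewrite -(rreprK p) -(rreprK q) -raddfD.
by rewrite !descend_scaleE scalerDl.
Qed.
HB.instance Definition _ := GRing.Zmodule_isLmodule.Build qring (descend NI)
  scaleA scale1 scaleDr scaleDl.
End Left.

Section Right.
Variable P : lmodType A^c.

Definition killsr : Prop := forall (a : A) (x : P), I a -> (a : A^c) *: x = 0.

Definition descendr of killsr : Type := P.

Variable PI : killsr.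
HB.instance Definition _ := GRing.Zmodule.copy (descendr PI) P.

Definition descendr_scale (q : qring^c) (x : descendr PI) : descendr PI :=
  (rrepr q : A^c) *: (x : P).

Lemma descendr_scaleE (a : A) x :
  descendr_scale (rpi a) x = (a : A^c) *: (x : P).
Proof.
apply/eqP; rewrite -subr_eq0 -[X in X == 0](@scalerBl A^c).
by apply/eqP/PI/rreprP.
Qed.

Let scaleA p q x :
  descendr_scale p (descendr_scale q x) = descendr_scale (p * q) x.
Proof.
rewrite -(rreprK p) -(rreprK q); set a := rrepr p; set b := rrepr q.
have -> : (rpi a : qring^c) * rpi b = rpi (b * a) by symmetry; apply: rpiM.
by rewrite !descendr_scaleE (@scalerA A^c).
Qed.
Let scale1 : left_id 1 descendr_scale.
Proof. by move=> x; rewrite -[1]/(rpi 1) descendr_scaleE (@scale1r A^c). Qed.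
Let scaleDr : right_distributive descendr_scale +%R.
Proof. by move=> q x y; apply: (@scalerDr A^c). Qed.
Let scaleDl x : {morph descendr_scale^~ x : p q / p + q}.
Proof.
move=> p q; rewrite -(rreprK p) -(rreprK q); set a := rrepr p; set b := rrepr q.
have -> : (rpi a : qring^c) + rpi b = rpi (a + b) by symmetry; apply: qpiD.
by rewrite !descendr_scaleE (@scalerDl A^c).
Qed.
HB.instance Definition _ := GRing.Zmodule_isLmodule.Build qring^c (descendr PI)
  scaleA scale1 scaleDr scaleDl.
End Right.
End QuotientRing.

Section QuotientAlgebra.
Variables (R : comPzRingType) (A : ralgType R) (I : ideal A).

Definition qralg (r : R) : qring I := rpi I (ralg r).
Lemma qralg_zmod : zmod_morphism qralg.
Proof. by move=> r s; rewrite /qralg !raddfB. Qed.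
Lemma qralg_monoid : monoid_morphism qralg.
Proof. by split=> [|r s]; rewrite /qralg ?rmorph1 ?rmorphM. Qed.
HB.instance Definition _ := GRing.isZmodMorphism.Build R (qring I) qralg qralg_zmod.
HB.instance Definition _ := GRing.isMonoidMorphism.Build R (qring I) qralg qralg_monoid.

Lemma qralgC r (x : qring I) : qralg r * x = x * qralg r.
Proof. by rewrite -(rreprK x) -!rpiM ralgC. Qed.
HB.instance Definition _ := hasCentralMap.Build R (qring I) qralgC.
End QuotientAlgebra.

(* P is a right module and N a left module over the R-algebra B; their tensor *)
(* product over B is an R-module.                                             *)
Section Tensor.
Variables (R : comPzRingType) (B : ralgType R) (P : lmodType B^c).

Section Def.
Variable (N : lmodType B).

Local Notation "[ p , n ]" := (@free_gen R (P * N)%type (p, n)).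

Definition tensor_rel (t : free R (P * N)%type) : Prop :=
  [\/ exists p p' n, t = [p + p', n] - [p, n] - [p', n],
      exists p n n', t = [p, n + n'] - [p, n] - [p, n'],
      exists p (b : B) n, t = [(b : B^c) *: p, n] - [p, b *: n] |
      exists (r : R) p n, t = r *: [p, n] - [(ralg r : B^c) *: p, n] ].

Definition tensor : lmodType R := qmod (span tensor_rel).

Definition tens (p : P) (n : N) : tensor := mpi (span tensor_rel) [p, n].

Let tens_eq x y : tensor_rel (x - y) ->
  mpi (span tensor_rel) x = mpi (span tensor_rel) y.
Proof.
move=> xy; apply/eqP; rewrite -subr_eq0 -raddfB; apply/eqP/mpi_eq0.
exact: span_gen.
Qed.

Lemma tensDl p p' n : tens (p + p') n = tens p n + tens p' n.
Proof.
by rewrite /tens -raddfD; apply: tens_eq; rewrite opprD addrA; apply: Or41; exists p, p', n.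
Qed.
Lemma tensDr p n n' : tens p (n + n') = tens p n + tens p n'.
Proof.
by rewrite /tens -raddfD; apply: tens_eq; rewrite opprD addrA; apply: Or42; exists p, n, n'.
Qed.
Lemma tensM p (b : B) n : tens ((b : B^c) *: p) n = tens p (b *: n).
Proof. by apply: tens_eq; apply: Or43; exists p, b, n. Qed.
Lemma tensZ (r : R) p n : r *: tens p n = tens ((ralg r : B^c) *: p) n.
Proof. by rewrite /tens -linearZ; apply: tens_eq; apply: Or44; exists r, p, n. Qed.
End Def.

Section Map.
Variables (N N' : lmodType B) (g : {linear N -> N'}).

Definition tensor_map_free : {linear free R (P * N)%type -> tensor N'} :=
  free_lift (fun x : P * N => tens x.1 (g x.2)).

Lemma tensor_map_rel t : span (@tensor_rel N) t -> tensor_map_free t = 0.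
Proof.
have k0 : tensor_map_free 0 = 0 by rewrite raddf0.
have kB x y : tensor_map_free x = 0 -> tensor_map_free y = 0 ->
    tensor_map_free (x - y) = 0.
  by move=> x0 y0; rewrite linearB x0 y0 subr0.
pose U := @Subgroup _ (fun x => tensor_map_free x = 0) k0 kB.
have kZ b x : U x -> U (b *: x).
  move=> x0; have: tensor_map_free (b *: x) = 0.
    by rewrite linearZ /= -[RHS](scaler0 _ b); congr (_ *: _).
  by [].
move=> st; apply: (st (Submodule kZ)) => {t st} t /=.
case=> [[p [p' [n ->]]]|[p [n [n' ->]]]|[p [b [n ->]]]|[r [p [n ->]]]];
  rewrite !linearB ?linearZ /= !free_lift_gen /=.
- by rewrite tensDl -addrA -opprD subrr.
- by rewrite linearD tensDr -addrA -opprD subrr.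
- by rewrite tensM linearZ subrr.
- by rewrite tensZ subrr.
Qed.

Definition tensor_map : {linear tensor N -> tensor N'} :=
  qmod_lift tensor_map_rel.

Lemma tensor_mapE p n : tensor_map (tens p n) = tens p (g n).
Proof. by rewrite [LHS]qmod_liftE /= free_lift_gen. Qed.
End Map.
End Tensor.

(* The standard free resolution of N: F_0 is free on the set N, and F_(n+1)   *)
(* is free on the set of elements of the n-th syzygy module ker (F_n -> ...). *)
Section Tor.
Variables (R : comPzRingType) (B : ralgType R).

Definition aug (V : lmodType B) : {linear free B V -> V} := free_lift idfun.

Fixpoint syzygy (N : lmodType B) (n : nat) : lmodType B :=
  if n is m.+1 then ker (aug (syzygy N m)) else N.

Definition res (N : lmodType B) (n : nat) : lmodType B := free B (syzygy N n).

Definition res_d (N : lmodType B) (n : nat) : {linear res N n.+1 -> res N n} :=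
  @ker_val B _ _ (aug (syzygy N n)) \o aug (syzygy N n.+1).

Lemma aug_surj V v : exists x, aug V x = v.
Proof. by exists (free_gen B v); rewrite /= free_lift_gen. Qed.

Lemma res_d0_exact N (x : res N 0) : aug N x = 0 <-> exists y, res_d N 0 y = x.
Proof.
split=> [x0|[y <-]]; last by apply/eqP; apply: (valP (aug _ y)).
have [y yE] := aug_surj (exist _ x (introT eqP x0) : ker (aug N)).
by exists y; rewrite /= [X in ker_val X]yE.
Qed.

Lemma res_d_exact N n (x : res N n.+1) :
  res_d N n x = 0 <-> exists y, res_d N n.+1 y = x.
Proof.
have -> : res_d N n x = 0 <-> aug (syzygy N n.+1) x = 0.
  split=> [x0|x0]; last by rewrite /res_d /= [X in ker_val X]x0.
  by apply: val_inj; rewrite [RHS]raddf0.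
exact: (res_d0_exact x).
Qed.

Definition Tor (P : lmodType B^c) (N : lmodType B) (n : nat) : lmodType R :=
  if n is m.+1 then homology (tensor_map P (res_d N m.+1)) (tensor_map P (res_d N m))
  else homology (tensor_map P (res_d N 0))
                (\0 : {linear tensor P (res N 0) -> tensor P (res N 0)}).
End Tor.

Section CellularAlgebra.
Variables (R : comPzRingType) (A : ralgType R).
Variables (d : Order.disp_t) (L : porderType d).

Definition comb (K : choiceType) (C : K -> A) (c : free R K) : A :=
  \sum_(k <- finsupp c) ralg (c k) * C k.

Definition cell_index (M : L -> finType) : choiceType :=
  {l : L & (M l * M l)%type}.

Definition cell_ix (M : L -> finType) (l : L) (S T : M l) : cell_index M :=
  Tagged (fun l => (M l * M l)%type) (S, T).

Definition cell_fam (M : L -> finType) (C : forall l, M l -> M l -> A)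
  (i : cell_index M) : A := C (tag i) (tagged i).1 (tagged i).2.

(* The module I_X; the instance X = {mu | mu < l} is A(< l).                  *)
Definition cell_span (M : L -> finType) (C : forall l, M l -> M l -> A)
    (X : set L) (a : A) : Prop :=
  exists2 c : free R (cell_index M),
    (forall i, i \in finsupp c -> X (tag i)) & a = comb (cell_fam C) c.

Record cell_datum := CellDatum {
  cellM : L -> finType;
  cellC : forall l, cellM l -> cellM l -> A;
  cell_star : A -> A;
  cellC_inj : injective (cell_fam cellC);
  cellC_basis : forall a, exists! c, a = comb (cell_fam cellC) c;
  cell_starD : {morph cell_star : x y / x + y};
  cell_starZ : forall r x, cell_star (ralg r * x) = ralg r * cell_star x;
  cell_starM : forall x y, cell_star (x * y) = cell_star y * cell_star x;
  cell_starK : involutive cell_star;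
  cell_starC : forall l (S T : cellM l), cell_star (cellC S T) = cellC T S;
  cell_mul : forall l (a : A), exists r : cellM l -> cellM l -> R,
    forall S T, cell_span cellC [set m | (m < l)%O]
      (a * cellC S T - \sum_(S' : cellM l) ralg (r S' S) * cellC S' T)
}.

Definition down_closed (X : set L) : Prop :=
  forall m l, (m <= l)%O -> X l -> X m.

Variable D : cell_datum.
Local Notation M := (cellM D).
Local Notation C := (@cellC D _).
Local Notation Ix := (cell_index M).
Local Notation fam := (cell_fam (@cellC D)).
Local Notation star := (cell_star D).

Lemma combD (c c' : free R Ix) : comb fam (c + c') = comb fam c + comb fam c'.
Proof.
apply: (@free_sumD R Ix A (fun k r => ralg r * fam k)) => [k|k r r'].
  by rewrite raddf0 mul0r.
by rewrite raddfD mulrDl.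
Qed.

Lemma combZ r (c : free R Ix) : comb fam (r *: c) = ralg r * comb fam c.
Proof.
rewrite /comb mulr_sumr.
have F0 k : ralg 0 * fam k = 0 :> A by rewrite raddf0 mul0r.
have rc : finsupp (r *: c) `<=` finsupp c.
  apply/fsubsetP => k; rewrite !mem_finsupp freeZ.
  by apply: contraNN => /eqP->; rewrite mulr0.
rewrite (@free_sum_widen R Ix A (fun k r => ralg r * fam k) F0 _ _ rc).
by apply: eq_bigr => k _; rewrite freeZ rmorphM mulrA.
Qed.

Lemma comb_gen i : comb fam (free_gen R i) = fam i.
Proof.
rewrite /comb (@free_sum_gen R Ix A (fun k r => ralg r * fam k)).
  by rewrite rmorph1 mul1r.
by move=> k; rewrite raddf0 mul0r.
Qed.

Definition cell_coef (a : A) : free R Ix := projT1 (cid (cellC_basis D a)).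

Lemma cell_coefE a : comb fam (cell_coef a) = a.
Proof. by rewrite /cell_coef; case: cid => c /= [<-]. Qed.

Lemma cell_coef_comb c : cell_coef (comb fam c) = c.
Proof. by rewrite /cell_coef; case: cid => c' /= [_]; apply. Qed.

Lemma cell_coefD a b : cell_coef (a + b) = cell_coef a + cell_coef b.
Proof. by rewrite -{1}(cell_coefE a) -{1}(cell_coefE b) -combD cell_coef_comb. Qed.

Lemma cell_coefZ r a : cell_coef (ralg r * a) = r *: cell_coef a.
Proof. by rewrite -{1}(cell_coefE a) -combZ cell_coef_comb. Qed.

Lemma cell_coef_fam i : cell_coef (fam i) = free_gen R i.
Proof. by rewrite -comb_gen cell_coef_comb. Qed.

Lemma cell_coef_sum (I : Type) (s : seq I) (F : I -> A) :
  cell_coef (\sum_(i <- s) F i) = \sum_(i <- s) cell_coef (F i).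
Proof.
apply: (big_morph cell_coef cell_coefD).
by apply: (addrI (cell_coef 0)); rewrite -cell_coefD !addr0.
Qed.

Lemma cell_spanP (X : set L) a : cell_span (@cellC D) X a <->
  (forall i, i \in finsupp (cell_coef a) -> X (tag i)).
Proof.
split=> [[c cX ->]|aX]; first by rewrite cell_coef_comb.
by exists (cell_coef a) => //; rewrite cell_coefE.
Qed.

Lemma cell_span0 X : cell_span (@cellC D) X 0.
Proof.
exists 0; first by move=> i; rewrite mem_finsupp free0 eqxx.
by rewrite -[0 in RHS](scale0r 0) combZ rmorph0 mul0r.
Qed.

Lemma cell_spanD X a b : cell_span (@cellC D) X a -> cell_span (@cellC D) X b ->
  cell_span (@cellC D) X (a + b).
Proof.
move=> /cell_spanP Xa /cell_spanP Xb; apply/cell_spanP => i.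
rewrite cell_coefD mem_finsupp freeD => ab.
have [ia|ia] := boolP (i \in finsupp (cell_coef a)); first exact: Xa.
apply: Xb; rewrite mem_finsupp; apply: contraNneq ab => ->.
by rewrite fsfun_dflt // addr0.
Qed.

Lemma cell_spanZ X r a : cell_span (@cellC D) X a ->
  cell_span (@cellC D) X (ralg r * a).
Proof.
move=> /cell_spanP Xa; apply/cell_spanP => i.
rewrite cell_coefZ mem_finsupp freeZ => ra; apply: Xa.
by rewrite mem_finsupp; apply: contraNneq ra => ->; rewrite mulr0.
Qed.

Lemma cell_spanB X a b : cell_span (@cellC D) X a -> cell_span (@cellC D) X b ->
  cell_span (@cellC D) X (a - b).
Proof.
move=> Xa Xb; apply: cell_spanD => //.
by rewrite -mulN1r -(rmorph1 (ralg : {rmorphism R -> A})) -rmorphN; apply: cell_spanZ.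
Qed.

Lemma cell_span_sum X (I : eqType) (s : seq I) (F : I -> A) :
  (forall i, i \in s -> cell_span (@cellC D) X (F i)) ->
  cell_span (@cellC D) X (\sum_(i <- s) F i).
Proof.
move=> XF; rewrite big_seq; elim/big_ind: _ => //; first exact: cell_span0.
exact: cell_spanD.
Qed.

Lemma cell_spanC X l (S T : M l) : X l -> cell_span (@cellC D) X (C S T).
Proof.
move=> Xl; apply/cell_spanP => i; rewrite (cell_coef_fam (cell_ix S T)).
by rewrite mem_finsupp free_genE; case: (i =P cell_ix S T) => [-> //|_]; rewrite eqxx.
Qed.

Lemma cell_spanS (X Y : set L) a : (forall l, X l -> Y l) ->
  cell_span (@cellC D) X a -> cell_span (@cellC D) Y a.
Proof. by move=> XY [c cX ->]; exists c => // i /cX /XY. Qed.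

Lemma cell_star_sum (I : Type) (s : seq I) (F : I -> A) :
  star (\sum_(i <- s) F i) = \sum_(i <- s) star (F i).
Proof.
apply: (big_morph star (cell_starD D)).
by apply: (addrI (star 0)); rewrite -cell_starD !addr0.
Qed.

Lemma cell_span_star X a : cell_span (@cellC D) X a ->
  cell_span (@cellC D) X (star a).
Proof.
move=> [c cX ->]; rewrite cell_star_sum; apply: cell_span_sum => i /cX Xi.
by rewrite cell_starZ cell_starC; apply/cell_spanZ/cell_spanC.
Qed.

Lemma cell_spanMl X a x : down_closed X ->
  cell_span (@cellC D) X x -> cell_span (@cellC D) X (a * x).
Proof.
move=> dX [c cX ->]; rewrite mulr_sumr; apply: cell_span_sum => -[l [S T]] /cX /= Xl.
rewrite mulrA -ralgC -mulrA; apply: cell_spanZ.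
rewrite /cell_fam /=; have [r /(_ S T) rST] := cell_mul D l a.
rewrite -(subrK (\sum_(S' : M l) ralg (r S' S) * C S' T) (a * _)).
apply: cell_spanD.
  by apply: cell_spanS rST => m /= /ltW ml; apply: dX Xl.
by apply: cell_span_sum => S' _; apply/cell_spanZ/cell_spanC.
Qed.

Lemma cell_spanMr X a x : down_closed X ->
  cell_span (@cellC D) X x -> cell_span (@cellC D) X (x * a).
Proof.
move=> dX Xx; rewrite -(cell_starK D (x * a)) cell_starM.
by apply/cell_span_star/cell_spanMl/cell_span_star.
Qed.

Definition cell_ideal (X : set L) (dX : down_closed X) : ideal A :=
  @Ideal A (Subgroup (@cell_span0 X) (@cell_spanB X))
    (fun a x => @cell_spanMl X a x dX) (fun a x => @cell_spanMr X a x dX).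

Let freeE_sum (I : Type) (s : seq I) (F : I -> free R Ix) (i : Ix) :
  (\sum_(k <- s) F k : free R Ix) i = \sum_(k <- s) F k i.
Proof.
exact: (big_morph (fun f : free R Ix => f i) (fun f g => freeD f g i) (free0 _ _)).
Qed.

(* r_a(S', S)                                                                 *)
Definition cell_r (l : L) (a : A) : M l -> M l -> R :=
  projT1 (cid (cell_mul D l a)).

Lemma cell_rP l a (S T : M l) : cell_span (@cellC D) [set m | (m < l)%O]
  (a * C S T - \sum_(S' : M l) ralg (cell_r a S' S) * C S' T).
Proof. by rewrite /cell_r; case: cid => r /= /(_ S T). Qed.

Lemma cell_coef_low l a (S T : M l) :
  cell_span (@cellC D) [set m | (m < l)%O] a -> cell_coef a (cell_ix S T) = 0.
Proof.
move=> /cell_spanP alt; rewrite fsfun_dflt //.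
by apply/negP => /alt /=; rewrite ltxx.
Qed.

Lemma cell_coefC l (S T S' T' : M l) :
  cell_coef (C S T) (cell_ix S' T') = ((S' == S) && (T' == T))%:R.
Proof.
rewrite (cell_coef_fam (cell_ix S T)) free_genE.
by rewrite /cell_ix eq_Tagged /= xpair_eqE.
Qed.

Lemma cell_rE l a (S' S T : M l) :
  cell_coef (a * C S T) (cell_ix S' T) = cell_r a S' S.
Proof.
rewrite -(subrK (\sum_(S1 : M l) ralg (cell_r a S1 S) * C S1 T) (a * _)).
rewrite cell_coefD freeD cell_coef_low ?add0r; last exact: cell_rP.
rewrite cell_coef_sum freeE_sum (bigD1 S') //= big1 => [|S1 S1S'];
  rewrite cell_coefZ freeZ cell_coefC !eqxx andbT.
  by rewrite mulr1 addr0.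
by rewrite eq_sym (negPf S1S') mulr0.
Qed.

Lemma cell_rM l a b (S' S : M l) :
  cell_r (a * b) S' S = \sum_(S1 : M l) cell_r a S' S1 * cell_r b S1 S.
Proof.
rewrite -(cell_rE _ S' S S) -mulrA.
rewrite -(subrK (\sum_(S1 : M l) ralg (cell_r b S1 S) * C S1 S) (b * _)) mulrDr.
rewrite cell_coefD freeD cell_coef_low ?add0r; last first.
  by apply: cell_spanMl (cell_rP b S S) => m n /= mn; apply: le_lt_trans.
rewrite mulr_sumr cell_coef_sum freeE_sum; apply: eq_bigr => S1 _.
by rewrite mulrA -ralgC -mulrA cell_coefZ freeZ cell_rE mulrC.
Qed.

(* W(l), the function u standing for the sum of the u S C_S; R acts on it     *)
(* through A.                                                                 *)
Definition cell_module (l : L) : Type := {ffun M l -> R}.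
HB.instance Definition _ l := GRing.Zmodule.on (cell_module l).

Definition cell_basis (l : L) (S : M l) : cell_module l :=
  [ffun S' => (S' == S)%:R].

Section CellModule.
Variable l : L.
Implicit Types u v : cell_module l.

Definition cell_act (a : A) u : cell_module l :=
  [ffun S' => \sum_(S : M l) cell_r a S' S * (u : {ffun _ -> _}) S].

Let actA a b u : cell_act a (cell_act b u) = cell_act (a * b) u.
Proof.
apply/ffunP => S'; rewrite !ffunE.
under eq_bigr do rewrite ffunE mulr_sumr.
rewrite exchange_big; apply: eq_bigr => S _ /=.
by rewrite cell_rM mulr_suml; apply: eq_bigr => S1 _; rewrite mulrA.
Qed.
Let act1 : left_id 1 cell_act.
Proof.
move=> u; apply/ffunP => S'; rewrite ffunE (bigD1 S') //= big1 => [|S SS'];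
  rewrite -(cell_rE _ _ _ S') mul1r cell_coefC !eqxx andbT.
  by rewrite mul1r addr0.
by rewrite eq_sym (negPf SS') mul0r.
Qed.
Let actDr : right_distributive cell_act +%R.
Proof.
move=> a u v; apply/ffunP => S'; rewrite !ffunE -big_split /=.
by apply: eq_bigr => S _; rewrite ffunE mulrDr.
Qed.
Let actDl u : {morph cell_act^~ u : a b / a + b}.
Proof.
move=> a b; apply/ffunP => S'; rewrite !ffunE -big_split /=.
apply: eq_bigr => S _.
by rewrite -!(cell_rE _ _ _ S) mulrDl cell_coefD freeD mulrDl.
Qed.
HB.instance Definition _ := GRing.Zmodule_isLmodule.Build A (cell_module l)
  actA act1 actDr actDl.

Lemma cell_ralgZ r u : ralg r *: u = [ffun S => r * (u : {ffun _ -> _}) S].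
Proof.
apply/ffunP => S'; rewrite !ffunE (bigD1 S') //= big1 => [|S SS'];
  rewrite -(cell_rE _ _ _ S') cell_coefZ freeZ cell_coefC !eqxx andbT.
  by rewrite mulr1 addr0.
by rewrite eq_sym (negPf SS') mulr0 mul0r.
Qed.
End CellModule.

(* phi_l (C_T, C_S), as the coefficient of C_(T,S) in C_(T,T) C_(S,S), that   *)
(* is, with S1 := T and T2 := S; cell_form_basisP shows that any other choice *)
(* of S1 and T2 gives the same scalar.                                        *)
Definition cell_form_basis (l : L) (T S : M l) : R :=
  cell_coef (C T T * C S S) (cell_ix T S).

Lemma cell_coef_star a l (S T : M l) :
  cell_coef (star a) (cell_ix S T) = cell_coef a (cell_ix T S).
Proof.
rewrite -{1}(cell_coefE a) cell_star_sum cell_coef_sum freeE_sum.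
rewrite -[in RHS](cell_coefE a) cell_coef_sum freeE_sum.
apply: eq_bigr => -[m [U V]] _; rewrite cell_starZ cell_starC !cell_coefZ !freeZ.
congr (_ * _); rewrite (cell_coef_fam (cell_ix V U)) (cell_coef_fam (cell_ix U V)).
rewrite !free_genE; congr ((_ : bool)%:R); rewrite /cell_ix.
have [e|ne] := eqVneq l m; last by rewrite -!tag_eqE /tag_eq /= (negPf ne).
by case: _ / e in U V *; rewrite !eq_Tagged /= !xpair_eqE andbC.
Qed.

Lemma cell_form_indepr l (S1 T S T2 T2' : M l) :
  cell_coef (C S1 T * C S T2) (cell_ix S1 T2) =
  cell_coef (C S1 T * C S T2') (cell_ix S1 T2').
Proof. by rewrite !cell_rE. Qed.

Lemma cell_form_basisP l (T S S1 T2 : M l) :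
  cell_coef (C S1 T * C S T2) (cell_ix S1 T2) = cell_form_basis T S.
Proof.
rewrite /cell_form_basis (cell_form_indepr _ _ _ _ S) -cell_coef_star cell_starM.
rewrite !cell_starC (cell_form_indepr _ _ _ _ T) -cell_coef_star cell_starM.
by rewrite !cell_starC.
Qed.

Definition cell_form (l : L) (u v : cell_module l) : R :=
  \sum_(T : M l) \sum_(S : M l) u T * v S * cell_form_basis T S.

Lemma cell_formE l (T S : M l) :
  cell_form (cell_basis T) (cell_basis S) = cell_form_basis T S.
Proof.
rewrite /cell_form (bigD1 T) //= [X in _ + X]big1 => [|T' T'T].
  rewrite addr0 (bigD1 S) //= big1 => [|S' S'S]; rewrite !ffunE eqxx.
    by rewrite eqxx !mul1r addr0.
  by rewrite (negPf S'S) mulr0 mul0r.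
by rewrite big1 // => S' _; rewrite !ffunE (negPf T'T) !mul0r.
Qed.

Lemma cell_ideal_kills (X Y : set L) (dX : down_closed X) (dY : down_closed Y)
    (N : lmodType A) : (Y `<=` X)%classic ->
  kills (cell_ideal dX) N -> kills (cell_ideal dY) N.
Proof. by move=> YX NX a x /(cell_spanS YX); apply: NX. Qed.

Lemma cell_ideal_killsr (X Y : set L) (dX : down_closed X) (dY : down_closed Y)
    (P : lmodType A^c) : (Y `<=` X)%classic ->
  killsr (cell_ideal dX) P -> killsr (cell_ideal dY) P.
Proof. by move=> YX PX a x /(cell_spanS YX); apply: PX. Qed.

End CellularAlgebra.

Arguments cell_ideal_kills {R A d L D X Y dX} dY {N} YX NX.
Arguments cell_ideal_killsr {R A d L D X Y dX} dY {P} YX PX.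

(* Main.v *)
(* Let I <= J be ideals of A, B = A / I and B' = A / J, and suppose that the   *)
(* left B-module J / I has a dual basis (pi t, e t) with e t in J / I; then    *)
(* J / I is projective and idempotent. Let V be a B-module mapping onto a      *)
(* B'-module V', the kernel G being projective with P (x) G -> P (x) V         *)
(* injective. The kernel H of free B V -> free B' V' is a summand of free B V  *)
(* up to vectors with coordinates in J / I, which die after tensoring with P.  *)
(* As G is projective, the kernel of the map of syzygies is a direct summand   *)
(* of H, so this map satisfies the same hypotheses, and diagram chasing        *)
(* identifies the kernels of P (x) ker (aug V) -> P (x) free B V and of its    *)
(* analogue over B', which are Tor_1. As Tor_(n+1) (P, N) is Tor_1 of the n-th *)
(* syzygy, starting from V = V' = N gives Tor over B and over B' in all        *)
(* degrees.                                                                    *)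
(*   If X is Y with one more cell l, then I_X / I_Y is such an ideal of        *)
(* A / I_Y: pi t keeps the terms C S t of the cell l, and e t is the sum of    *)
(* the v U *: C U t, where phi (C_t, v) = 1. Cells of X \ Y are added to Y     *)
(* one by one, always taking a minimal one.                                    *)

From HB Require Import structures.
From mathcomp Require Import all_boot all_order all_algebra.
From mathcomp Require Import finmap boolp classical_sets cardinality.
Require Import Defs.

Set Implicit Arguments.
Unset Strict Implicit.
Unset Printing Implicit Defensive.

Import Order.TTheory GRing.Theory.
Local Open Scope classical_set_scope.
Local Open Scope ring_scope.

(** Let B = A / I and B' = A / J, where J / I has a finite dual basis [pi t], [e t] with values in J
    / I itself. Then J / I is projective on the left and P (x) J / I vanishes: in p (x) b = sum of p
    (x) [pi t b * e t] the scalar [pi t b] crosses over to P, which it kills. By 0 -> J / I -> B ->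
    B' -> 0, free B'-modules have no higher Tor over B against P, so a free resolution over B'
    already computes Tor over B. Since [Tor] is defined by the standard resolution, this is realised
    by comparing the syzygies of N over the two rings: [admissible] is the relation that persists
    ([admissible_syzygy]), [tensor_ker_iso] extracts from it an isomorphism of Tor, and
    [tor_dual_basis_iso] covers all degrees. For one cell l, [cell_dual_basis] supplies the dual
    basis: modulo lower cells, C_{S,t} C_{U,t} is phi(C_t, C_U) C_{S,t}, so a vector v with phi(C_t,
    v) = 1 yields an element, the sum of the v_U C_{U,t}, that fixes every C_{S,t} from the right.
    [tor_cells] then iterates over the cells. *)

Definition iso (B : pzRingType) (V W : lmodType B) : Prop :=
  exists f : {linear V -> W}, bijective f.

Lemma bij_of_inj_surj (T U : Type) (f : T -> U) :
  injective f -> (forall y, exists x, f x = y) -> bijective f.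
Proof.
move=> finj /choice[g gK]; exists g => // x.
by apply: finj; rewrite gK.
Qed.

(** * Isomorphisms, kernels and homology *)

Section Iso.
Variable B : pzRingType.
Implicit Types U V W Z : lmodType B.

Lemma iso_refl V : iso V V.
Proof. by exists idfun; exists idfun. Qed.

Lemma iso_sym V W : iso V W -> iso W V.
Proof.
move=> [f [g fK gK]].
have glin : linear g by move=> b x y; apply: (can_inj fK); rewrite linearP !gK.
pose gL := GRing.isLinear.Build B W V *:%R g glin.
pose g' : {linear W -> V} := HB.pack g gL.
by exists g'; exists f.
Qed.

Lemma iso_trans U V W : iso U V -> iso V W -> iso U W.
Proof. by move=> [f fb] [g gb]; exists (g \o f); apply: bij_comp. Qed.

Lemma iso_inj_surj V W (f : {linear V -> W}) :
  (forall x, f x = 0 -> x = 0) -> (forall y, exists x, f x = y) -> iso V W.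
Proof.
move=> f0 fsurj; exists f; apply: bij_of_inj_surj => // x y /eqP.
by rewrite -subr_eq0 -linearB => /eqP /f0 /eqP; rewrite subr_eq0 => /eqP.
Qed.

Lemma ker_lift U V W (f : {linear U -> V}) (g : {linear V -> W}) :
  (forall x, g (f x) = 0) -> exists k : {linear U -> ker g},
    forall x, ker_val (k x) = f x.
Proof.
move=> gf; pose k x : ker g := exist _ (f x) (introT eqP (gf x)).
have klin : linear k by move=> b x y; apply: val_inj; apply: linearP.
pose kL := GRing.isLinear.Build B U (ker g) *:%R k klin.
pose k' : {linear U -> ker g} := HB.pack k kL.
by exists k'.
Qed.

Lemma ker_valP V W (f : {linear V -> W}) (x : ker f) : f (ker_val x) = 0.
Proof. exact/eqP/(valP x). Qed.

Lemma ker_val_inj V W (f : {linear V -> W}) : injective (@ker_val _ _ _ f).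
Proof. by move=> x y /val_inj. Qed.

Lemma ker_val_surj V W (f : {linear V -> W}) v :
  f v = 0 -> exists x : ker f, ker_val x = v.
Proof. by move=> /eqP fv; exists (exist _ v fv). Qed.

(** Only the restriction of [c] to the kernels matters; [c] itself need not be injective. *)
Lemma ker_iso V V' W W' (f : {linear V -> W}) (f' : {linear V' -> W'})
    (c : {linear V -> V'}) :
  (forall x, f x = 0 -> f' (c x) = 0) ->
  (forall x, f x = 0 -> c x = 0 -> x = 0) ->
  (forall x', f' x' = 0 -> exists2 x, f x = 0 & c x = x') ->
  iso (ker f) (ker f').
Proof.
move=> cf c0 csurj.
have [|k kE] := @ker_lift (ker f) V' W' (c \o @ker_val _ _ _ f) f'.
  by move=> x; apply/cf/ker_valP.
apply: (iso_inj_surj (f := k)) => [x kx|y].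
  apply: ker_val_inj; rewrite raddf0; apply: c0; first exact: ker_valP.
  by rewrite -[LHS]kE kx raddf0.
have [x /ker_val_surj[x1 <-] cx] := csurj _ (ker_valP y).
by exists x1; apply: ker_val_inj; rewrite kE.
Qed.

(** [p] identifies [V] modulo boundaries with [Z], and the cycles are the preimage under [p] of the
    kernel of [q]. *)
Lemma homology_iso U V W Z (f : {linear U -> V}) (g : {linear V -> W})
    (p : {linear V -> Z}) (q : {linear Z -> W}) :
  (forall x, g x = q (p x)) -> (forall z, exists x, p x = z) ->
  (forall x, p x = 0 <-> exists u, f u = x) ->
  iso (homology f g) (ker q).
Proof.
move=> gE psurj pker.
have [|k kE] := @ker_lift (ker g) Z W (p \o @ker_val _ _ _ g) q.
  by move=> x; rewrite /= -gE ker_valP.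
have h0 (x : ker g) : boundaries f g x -> k x = 0.
  by move=> /pker px; apply: ker_val_inj; rewrite kE raddf0.
have liftE x : qmod_lift h0 (mpi _ x) = k x := qmod_liftE h0 x.
apply: (@iso_inj_surj _ _ (qmod_lift h0)) => [r|z].
  rewrite -(mreprK r) => r0; apply/mpi_eq0/pker.
  by rewrite -[LHS]kE (etrans (esym (liftE _)) r0) raddf0.
have [x px] := psurj (ker_val z).
have [|x1 x1E] := @ker_val_surj _ _ g x; first by rewrite gE px ker_valP.
by exists (mpi _ x1); apply: ker_val_inj; rewrite [X in ker_val X]liftE kE /= x1E.
Qed.

End Iso.

(** * Free modules *)

Section FreeFacts.
Variables (B : pzRingType) (K : choiceType).

Lemma free_sum_coef (I : Type) (s : seq I) (F : I -> free B K) k :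
  (\sum_(i <- s) F i : free B K) k = \sum_(i <- s) F i k.
Proof.
exact: (big_morph (fun f : free B K => f k) (fun f g => freeD f g k) (free0 _ _)).
Qed.

Lemma free_decomp (f : free B K) :
  f = \sum_(k <- finsupp f) f k *: (free_gen B k : free B K).
Proof.
apply/fsfunP => j; rewrite free_sum_coef.
under eq_bigr do rewrite freeZ free_genE.
case: (finsuppP f j) => [jf|jf].
  rewrite big_seq big1 // => k kf; case: eqP => [jk|]; last by rewrite mulr0.
  by rewrite jk kf in jf.
rewrite (bigD1_seq j) ?fset_uniq //= eqxx mulr1 big1 ?addr0 // => k kj.
by rewrite eq_sym (negPf kj) mulr0.
Qed.

Lemma free_linear_ext (W : lmodType B) (f g : {linear free B K -> W}) :
  (forall k, f (free_gen B k) = g (free_gen B k)) -> f =1 g.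
Proof.
move=> fg x; rewrite (free_decomp x) !linear_sum; apply: eq_bigr => k _.
by rewrite !linearZ /= fg.
Qed.
End FreeFacts.

(** * Right exactness of the tensor product *)

Section TensorFacts.
Variables (R : comPzRingType) (B : ralgType R) (P : lmodType B^c).

(** Scalars need no case, because [tensZ] absorbs them into the first factor. *)
Lemma tensor_ind (V : lmodType B) (Q : tensor P V -> Prop) :
  (forall p v, Q (tens p v)) -> (forall s t, Q s -> Q t -> Q (s + t)) ->
  forall t, Q t.
Proof.
move=> Qt QD t; have t0 v : tens (0 : P) v = 0 :> tensor P V.
  by apply: (addrI (tens 0 v)); rewrite -tensDl !addr0.
rewrite -(mreprK t) (free_decomp (mrepr t)) linear_sum.
elim/big_ind: _ => [|//|[p v] _]; first by rewrite -(t0 0).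
by rewrite linearZ /= [_ *: _](tensZ _ p v).
Qed.

Lemma tens0r (V : lmodType B) p : tens p (0 : V) = 0 :> tensor P V.
Proof. by apply: (addrI (tens p 0)); rewrite -tensDr !addr0. Qed.

Lemma tensNr (V : lmodType B) p (v : V) : tens p (- v) = - tens p v :> tensor P V.
Proof. by apply/eqP; rewrite -addr_eq0 -tensDr addNr tens0r. Qed.

Lemma tens0l (V : lmodType B) (v : V) : tens 0 v = 0 :> tensor P V.
Proof. by apply: (addrI (tens 0 v)); rewrite -tensDl !addr0. Qed.

Lemma tens_sumr (V : lmodType B) p (I : Type) (s : seq I) (F : I -> V) :
  tens p (\sum_(i <- s) F i) = \sum_(i <- s) tens p (F i) :> tensor P V.
Proof. exact: (big_morph (fun v => tens p v : tensor P V) (tensDr p) (tens0r _ p)). Qed.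

Lemma tensor_linear_ext (V : lmodType B) (W : lmodType R)
    (f g : {linear tensor P V -> W}) :
  (forall p v, f (tens p v) = g (tens p v)) -> f =1 g.
Proof.
move=> fg; apply: tensor_ind => // s t fs ft.
by rewrite !linearD fs ft.
Qed.

Section Lift.
Variables (V : lmodType B) (W : lmodType R) (b : P -> V -> W).
Hypothesis bDl : forall p p' v, b (p + p') v = b p v + b p' v.
Hypothesis bDr : forall p v v', b p (v + v') = b p v + b p v'.
Hypothesis bM : forall p (a : B) v, b ((a : B^c) *: p) v = b p (a *: v).
Hypothesis bZ : forall (r : R) p v, r *: b p v = b ((ralg r : B^c) *: p) v.

Lemma tensor_lift : exists f : {linear tensor P V -> W},
  forall p v, f (tens p v) = b p v.
Proof.
pose f0 : {linear free R (P * V)%type -> W} :=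
  free_lift (fun x : P * V => b x.1 x.2).
have f0E k : f0 (free_gen R k) = b k.1 k.2 by apply: free_lift_gen.
have f0U t : span (@tensor_rel R B P V) t -> f0 t = 0.
  have kB x y : f0 x = 0 -> f0 y = 0 -> f0 (x - y) = 0.
    by move=> x0 y0; rewrite linearB x0 y0 subr0.
  pose U := @Subgroup _ (fun x => f0 x = 0) (raddf0 f0) kB.
  have kZ a x : U x -> U (a *: x).
    by move=> x0; have: f0 (a *: x) = 0 by rewrite linearZ /= [f0 x]x0 scaler0.
  move=> st; apply: (st (Submodule kZ)) => {t st} t /=.
  case=> [[p [p' [n ->]]]|[p [n [n' ->]]]|[p [a [n ->]]]|[r [p [n ->]]]];
    rewrite !linearB ?linearZ /= !f0E /=.
  - by rewrite bDl -addrA -opprD subrr.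
  - by rewrite bDr -addrA -opprD subrr.
  - by rewrite bM subrr.
  - by rewrite bZ subrr.
exists (qmod_lift f0U) => p v.
by rewrite [LHS]qmod_liftE f0E.
Qed.
End Lift.

Lemma tensor_map_comp (U V W : lmodType B) (f : {linear V -> W})
    (g : {linear U -> V}) (h : {linear U -> W}) t :
  (forall x, h x = f (g x)) ->
  tensor_map P h t = tensor_map P f (tensor_map P g t).
Proof.
move=> hE; move: t; apply: (tensor_linear_ext (g := tensor_map P f \o tensor_map P g)).
move=> p v; rewrite -[RHS]/(tensor_map P f (tensor_map P g (tens p v))).
by rewrite !tensor_mapE hE.
Qed.
End TensorFacts.

(** * Tensor products under change of rings *)

Section Compare.
Variables (R : comPzRingType) (B B' : ralgType R) (rho : {rmorphism B -> B'}).
Hypothesis rho_ralg : forall r, rho (ralg r) = ralg r.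
Variables (P : lmodType B^c) (P' : lmodType B'^c) (theta : P -> P').
Hypothesis thetaD : {morph theta : p q / p + q}.
Hypothesis thetaZ : forall (b : B) p,
  theta ((b : B^c) *: p) = (rho b : B'^c) *: theta p.

Section Def.
Variables (V : lmodType B) (V' : lmodType B') (h : V -> V').
Hypothesis hD : {morph h : x y / x + y}.
Hypothesis hZ : forall b x, h (b *: x) = rho b *: h x.

Lemma tensor_compare : exists c : {linear tensor P V -> tensor P' V'},
  forall p v, c (tens p v) = tens (theta p) (h v).
Proof.
apply: tensor_lift => [p p' v|p v v'|p a v|r p v].
- by rewrite thetaD tensDl.
- by rewrite hD tensDr.
- by rewrite thetaZ hZ tensM.
- by rewrite thetaZ rho_ralg tensZ.
Qed.

Hypothesis rho_surj : forall b', exists b, rho b = b'.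
Hypothesis theta_bij : bijective theta.
Hypothesis h_surj : forall v', exists v, h v = v'.
Variable c : {linear tensor P V -> tensor P' V'}.
Hypothesis cE : forall p v, c (tens p v) = tens (theta p) (h v).

Lemma tensor_compare_surj t' : exists t, c t = t'.
Proof.
have [eta _ etaK] := theta_bij.
move: t'; apply: tensor_ind => [p' v'|s' t' [s <-] [t <-]].
  by have [v <-] := h_surj v'; exists (tens (eta p') v); rewrite cE etaK.
by exists (s + t); rewrite linearD.
Qed.

Variables (G : lmodType B) (i : {linear G -> V}).
Hypothesis iE : forall v, h v = 0 -> exists g, i g = v.

(** An inverse to [c] modulo the image of [i] sends p' (x) v' to the class of a tensor of preimages:
    two preimages of v' differ by an element of the kernel of [h], which comes from [G]. With [rho]
    and [theta] identities this is ordinary right exactness. *)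
Lemma tensor_compare_exact t : c t = 0 -> exists s, tensor_map P i s = t.
Proof.
have [eta thetaK etaK] := theta_bij; have thetaI := can_inj thetaK.
have [sig sigK] := choice h_surj.
have h0 : h 0 = 0 by apply: (addrI (h 0)); rewrite -hD !addr0.
have hN x : h (- x) = - h x.
  by apply/eqP; rewrite -addr_eq0 -hD addNr h0.
pose im t := exists s, tensor_map P i s = t.
have im0 : im 0 by exists 0; rewrite raddf0.
have imB x y : im x -> im y -> im (x - y).
  by move=> [s <-] [s' <-]; exists (s - s'); rewrite linearB.
have imZ r x : @Subgroup _ im im0 imB x -> @Subgroup _ im im0 imB (r *: x).
  by move=> [s <-]; exists (r *: s); rewrite linearZ.
pose U : submodule (tensor P V) := Submodule imZ.
have tens_eq p v w : h v = h w -> mpi U (tens p v) = mpi U (tens p w).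
  move=> hvw; have /iE[g gE] : h (v - w) = 0 by rewrite hD hN hvw subrr.
  apply/eqP; rewrite -subr_eq0 -raddfB; apply/eqP/mpi_eq0.
  exists (tens p g); rewrite tensor_mapE gE; apply/eqP.
  by rewrite eq_sym subr_eq -tensDr subrK.
have [f fE] : exists f : {linear tensor P' V' -> qmod U},
    forall p' v', f (tens p' v') = mpi U (tens (eta p') (sig v')).
  apply: tensor_lift => [p p' v|p v v'|p a v|r p v].
  - by rewrite -raddfD -tensDl; congr (mpi U (tens _ _)); apply: thetaI; rewrite thetaD !etaK.
  - by rewrite -raddfD -tensDr; apply: tens_eq; rewrite hD !sigK.
  - have [b <-] := rho_surj a.
    have -> : eta ((rho b : B'^c) *: p) = (b : B^c) *: eta p.
      by apply: thetaI; rewrite thetaZ !etaK.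
    by rewrite tensM; apply: tens_eq; rewrite hZ !sigK.
  - rewrite -linearZ /= tensZ; congr (mpi U (tens _ _)).
    by apply: thetaI; rewrite thetaZ !etaK rho_ralg.
have fc : f \o c =1 mpi U.
  apply: tensor_linear_ext => p v /=; rewrite cE fE thetaK.
  by apply: tens_eq; rewrite sigK.
by move=> ct; apply/(mpi_eq0 U); rewrite -fc /= ct raddf0.
Qed.
End Def.
End Compare.

Section TensorExact.
Variables (R : comPzRingType) (B : ralgType R) (P : lmodType B^c).
Variables (U V W : lmodType B) (i : {linear U -> V}) (f : {linear V -> W}).
Hypothesis f_surj : forall w, exists v, f v = w.
Hypothesis iE : forall v, f v = 0 -> exists g, i g = v.

Lemma tensor_map_surj t : exists s, tensor_map P f s = t.
Proof.
apply: (@tensor_compare_surj _ B B P P idfun V W f) => //; first by exists idfun.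
exact: tensor_mapE.
Qed.

Lemma tensor_map_exact t : tensor_map P f t = 0 -> exists s, tensor_map P i s = t.
Proof.
apply: (@tensor_compare_exact _ B B idfun _ P P idfun _ _ V W f) => //.
- exact: linearD.
- by move=> b x; rewrite linearZ.
- by move=> b; exists b.
- by exists idfun.
- exact: tensor_mapE.
Qed.
End TensorExact.

(** * Restriction of scalars *)

Section Restriction.
Variables (B B' : pzRingType) (rho : {rmorphism B -> B'}).

(** The morphism is a phantom argument: it records in the type which [B]-action is meant. *)
Definition restr of {rmorphism B -> B'} := fun V' : lmodType B' => V' : Type.

Variable V' : lmodType B'.
HB.instance Definition _ := GRing.Zmodule.on (restr rho V').

Definition restr_scale (b : B) (v : restr rho V') : restr rho V' :=
  rho b *: (v : V').

Let scaleA a b v : restr_scale a (restr_scale b v) = restr_scale (a * b) v.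
Proof. by rewrite /restr_scale rmorphM scalerA. Qed.
Let scale1 : left_id 1 restr_scale.
Proof. by move=> v; rewrite /restr_scale rmorph1 scale1r. Qed.
Let scaleDr : right_distributive restr_scale +%R.
Proof. by move=> b u v; apply: scalerDr. Qed.
Let scaleDl v : {morph restr_scale^~ v : a b / a + b}.
Proof. by move=> a b; rewrite /restr_scale rmorphD scalerDl. Qed.
HB.instance Definition _ := GRing.Zmodule_isLmodule.Build B (restr rho V')
  scaleA scale1 scaleDr scaleDl.

Lemma restrZ (b : B) (v : V') : b *: (v : restr rho V') = rho b *: v.
Proof. by []. Qed.
End Restriction.

Section RestrMap.
Variables (B B' : pzRingType) (rho : {rmorphism B -> B'}).
Variables (V' W' : lmodType B') (f : {linear V' -> W'}).

Definition restr_map (v : restr rho V') : restr rho W' := f v.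
Lemma restr_map_linear : linear restr_map.
Proof. by move=> b u v; rewrite /restr_map linearD restrZ linearZ. Qed.
HB.instance Definition _ := GRing.isLinear.Build B (restr rho V') (restr rho W')
  *:%R restr_map restr_map_linear.
End RestrMap.
Arguments restr_map {B B'} rho {V' W'} f v.

Section FreeScalars.
Variables (B B' : pzRingType) (rho : {rmorphism B -> B'}) (K : choiceType).

Definition free_restr : {linear free B K -> restr rho (free B' K)} :=
  free_lift (fun k => free_gen B' k : restr rho (free B' K)).

Lemma free_restrE z k : (free_restr z : free B' K) k = rho (z k).
Proof.
have -> : z k = \sum_(j <- finsupp z) z j * (k == j)%:R.
  rewrite [in LHS](free_decomp z) free_sum_coef.
  by apply: eq_bigr => j _; rewrite freeZ free_genE.
rewrite rmorph_sum [LHS](free_sum_coef (B := B')); apply: eq_bigr => j _.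
by rewrite restrZ freeZ free_genE rmorphM rmorph_nat.
Qed.

Lemma free_restr_surj : (forall b', exists b, rho b = b') ->
  forall z', exists z, free_restr z = z'.
Proof.
move=> /choice[sec secK] z'.
exists (\sum_(k <- finsupp z') sec (z' k) *: (free_gen B k : free B K)).
rewrite linear_sum [RHS]free_decomp; apply: eq_bigr => k _.
by rewrite linearZ /= free_lift_gen restrZ secK.
Qed.
End FreeScalars.

(** A splitting of the canonical surjection onto [G], making [G] a summand of a free module. *)
Definition projective (B : pzRingType) (G : lmodType B) : Prop :=
  exists s : {linear G -> free B G}, forall x, free_lift idfun (s x) = x.

(** * Tor and tensor kernels *)

Section TorKer.
Variables (R : comPzRingType) (B : ralgType R).
Variables (P : lmodType B^c) (N : lmodType B).

Lemma tor_exact (V : lmodType B) t :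
  tensor_map P (aug V) t = 0 <->
  exists u, tensor_map P (@ker_val _ _ _ (aug V) \o aug (ker (aug V))) u = t.
Proof.
set i := @ker_val _ _ _ (aug V).
have cE u : tensor_map P (i \o aug (ker (aug V))) u =
    tensor_map P i (tensor_map P (aug (ker (aug V))) u) by apply: tensor_map_comp.
split=> [/(tensor_map_exact (@aug_surj _ _ _) (@ker_val_surj _ _ _ _))[s <-]|[u <-]].
  by have [u <-] := tensor_map_surj (@aug_surj _ _ _) s; exists u.
rewrite cE; move: (tensor_map P _ u).
apply: (tensor_linear_ext (f := tensor_map P (aug V) \o tensor_map P i) (g := \0)).
move=> p x; rewrite -[LHS]/(tensor_map P (aug V) (tensor_map P i (tens p x))).
by rewrite !tensor_mapE [X in tens _ X]ker_valP tens0r.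
Qed.

Lemma tor0_iso : iso (Tor P N 0) (tensor P N).
Proof.
have [] := @homology_iso _ _ _ _ _ (tensor_map P (res_d N 0))
  (\0 : {linear tensor P (res N 0) -> tensor P (res N 0)})
  (tensor_map P (aug N)) \0.
- by [].
- exact: tensor_map_surj (@aug_surj _ _ _).
- exact: tor_exact.
move=> f fb; apply: (iso_trans (V := ker (\0 : {linear tensor P N -> tensor P (res N 0)}))).
  by exists f.
apply: (iso_inj_surj (f := @ker_val _ _ _ _)) => [x x0|y].
  by apply: ker_val_inj; rewrite x0.
exact: ker_val_surj.
Qed.

(** The outgoing differential factors through P (x) [syzygy N n.+1], and by [tor_exact] the
    boundaries are exactly what dies there. The kernel on the right is Tor_1 of the n-th syzygy. *)
Lemma torS_iso n : iso (Tor P N n.+1)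
  (ker (tensor_map P (@ker_val _ _ _ (aug (syzygy N n))))).
Proof.
apply: (@homology_iso _ _ _ _ _ (tensor_map P (res_d N n.+1))
  (tensor_map P (res_d N n)) (tensor_map P (aug (syzygy N n.+1)))).
- by move=> x; apply: tensor_map_comp.
- exact: tensor_map_surj (@aug_surj _ _ _).
- exact: tor_exact.
Qed.
End TorKer.

(** * Dividing by an idempotent projective ideal *)

Section DualBasis.
Variables (R : comPzRingType) (B B' : ralgType R) (rho : {rmorphism B -> B'}).
Variables (T : finType) (e : T -> B) (pi : T -> {additive B -> B}).
Hypothesis rho_e : forall t, rho (e t) = 0.
Hypothesis rho_pi : forall t b, rho b = 0 -> rho (pi t b) = 0.
Hypothesis piM : forall t a b, rho b = 0 -> pi t (a * b) = a * pi t b.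
Hypothesis pi_e : forall b, rho b = 0 -> b = \sum_t pi t b * e t.

Section Sum.
Variable K : choiceType.
Implicit Types z : free B K.

(** On vectors with coordinates in the kernel of [rho] this is [B]-linear, and for
    [g k t = e t *: u k] it is the linear extension of [u]. Elsewhere its value carries no
    meaning. *)
Definition dual_sum (W : lmodType B) (g : K -> T -> W) z : W :=
  \sum_(k <- finsupp z) \sum_t pi t (z k) *: g k t.

Lemma dual_sumP (W : lmodType B) (g : K -> T -> W) a z z' :
  (forall k, rho (z k) = 0) ->
  dual_sum g (a *: z + z') = a *: dual_sum g z + dual_sum g z'.
Proof.
move=> z0; rewrite /dual_sum; pose F k b := \sum_t pi t b *: g k t.
have F0 k : F k 0 = 0 by apply: big1 => t _; rewrite raddf0 scale0r.
have FD k b b' : F k (b + b') = F k b + F k b'.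
  by rewrite -big_split; apply: eq_bigr => t _; rewrite raddfD scalerDl.
rewrite (free_sumD F0 FD); congr (_ + _).
have zS : (finsupp (a *: z) `<=` finsupp z)%fset.
  apply/fsubsetP => k; rewrite !mem_finsupp freeZ.
  by apply: contraNN => /eqP->; rewrite mulr0.
rewrite (free_sum_widen F0 zS) scaler_sumr; apply: eq_bigr => k _.
rewrite scaler_sumr; apply: eq_bigr => t _.
by rewrite freeZ piM ?scalerA.
Qed.

Lemma dual_sum_map (W W' : lmodType B) (f : {linear W -> W'})
    (g : K -> T -> W) z : f (dual_sum g z) = dual_sum (fun k t => f (g k t)) z.
Proof.
rewrite linear_sum; apply: eq_bigr => k _.
by rewrite linear_sum; apply: eq_bigr => t _; rewrite linearZ.
Qed.

Lemma dual_sum_lift (W : lmodType B) (u : K -> W) z :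
  (forall k, rho (z k) = 0) ->
  dual_sum (fun k t => e t *: u k) z = free_lift u z.
Proof.
move=> z0; apply: eq_bigr => k _; rewrite [in RHS](pi_e (z0 k)) scaler_suml.
by apply: eq_bigr => t _; rewrite scalerA.
Qed.
End Sum.

Variables (P : lmodType B^c) (P' : lmodType B'^c) (theta : P -> P').
Hypothesis rho_ralg : forall r, rho (ralg r) = ralg r.
Hypothesis rho_surj : forall b', exists b, rho b = b'.
Hypothesis thetaD : {morph theta : p q / p + q}.
Hypothesis thetaZ : forall (b : B) p,
  theta ((b : B^c) *: p) = (rho b : B'^c) *: theta p.
Hypothesis theta_bij : bijective theta.

Lemma scale_ker (b : B) (p : P) : rho b = 0 -> (b : B^c) *: p = 0.
Proof.
move=> b0; have [eta thetaK _] := theta_bij; apply: (can_inj thetaK).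
rewrite thetaZ b0 [LHS](@scale0r B'^c).
by apply: (addrI (theta 0)); rewrite -thetaD !addr0.
Qed.

(** The coefficients [pi t (z k)] lie in the kernel of [rho]; moved across the tensor sign they
    annihilate [P]. *)
Lemma tens_dual_sum (K : choiceType) (W : lmodType B) (g : K -> T -> W)
    (z : free B K) p : (forall k, rho (z k) = 0) ->
  tens p (dual_sum g z) = 0 :> tensor P W.
Proof.
move=> z0; rewrite tens_sumr big1 // => k _; rewrite tens_sumr big1 // => t _.
by rewrite -tensM scale_ker ?tens0l // rho_pi.
Qed.

(** The invariant of the induction on syzygies. Projectivity of the kernel allows it to be lifted to
    [free B V]; injectivity after tensoring removes the obstruction to lifting Tor classes from [B']
    to [B]. *)
Definition admissible (V : lmodType B) (V' : lmodType B')
    (h : {linear V -> restr rho V'}) : Prop :=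
  [/\ forall v', exists v, h v = v',
      projective (ker h) &
      forall t, tensor_map P (@ker_val _ _ _ h) t = 0 -> t = 0].

Lemma admissible_bij (V : lmodType B) (V' : lmodType B')
    (h : {linear V -> restr rho V'}) : bijective h -> admissible h.
Proof.
move=> [g hK gK].
have ker0 (x : ker h) : x = 0.
  apply: ker_val_inj; rewrite raddf0; apply: (can_inj hK).
  by rewrite ker_valP raddf0.
split=> [v'||]; first by exists (g v').
  by exists \0 => x; rewrite raddf0 (ker0 x).
move=> t _; move: t; apply: tensor_ind => [p v|s t -> ->]; last exact: addr0.
by rewrite (ker0 v) tens0r.
Qed.

(** * Passing to the next syzygy *)

Section Step.
Variables (V : lmodType B) (V' : lmodType B') (h : {linear V -> restr rho V'}).

Definition free_map : {linear free B V -> restr rho (free B' V')} :=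
  free_lift (fun v => free_gen B' (h v : V') : restr rho (free B' V')).

Lemma aug_free_map x : aug V' (free_map x) = h (aug V x).
Proof.
pose f : {linear free B V -> restr rho V'} := restr_map rho (aug V') \o free_map.
pose g : {linear free B V -> restr rho V'} := h \o aug V.
suff: f x = g x by [].
apply: free_linear_ext => v; rewrite /f /g /= /restr_map free_lift_gen.
by rewrite !free_lift_gen.
Qed.

Lemma syzygy_map : exists k : {linear ker (aug V) -> restr rho (ker (aug V'))},
  forall x, ker_val (k x : ker (aug V')) = free_map (ker_val x).
Proof.
have k0 (x : ker (aug V)) : aug V' (free_map (ker_val x)) = 0.
  by rewrite aug_free_map ker_valP raddf0.
pose k x : restr rho (ker (aug V')) := exist _ (free_map (ker_val x) : free B' V')
  (introT eqP (k0 x)).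
have klin : linear k.
  by move=> b x y; apply: val_inj; rewrite /= linearP.
pose kL := GRing.isLinear.Build B _ (restr rho (ker (aug V'))) *:%R k klin.
pose k' : {linear ker (aug V) -> restr rho (ker (aug V'))} := HB.pack k kL.
by exists k'.
Qed.

Hypothesis h_adm : admissible h.

Lemma free_map_surj x' : exists x, free_map x = x'.
Proof.
have [hsurj _ _] := h_adm; have [sig sigK] := choice hsurj.
have [z <-] := free_restr_surj rho_surj x'.
exists (free_lift (fun v' => free_gen B (sig v')) z : free B V).
pose f : {linear free B V' -> restr rho (free B' V')} :=
  free_map \o free_lift (fun v' => free_gen B (sig v') : free B V).
suff: f z = free_restr rho V' z by [].
by apply: free_linear_ext => v'; rewrite /f /= !free_lift_gen sigK.
Qed.

Lemma ker_section : exists s : {linear ker h -> free B V},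
  forall g, aug V (s g) = ker_val g /\ free_map (s g) = 0.
Proof.
have [_ [s sK] _] := h_adm.
(* The generator at 0 is subtracted because [free_map] sends the generator at g to the generator at
   [h g] = 0, which is not the zero vector; [aug V] does not see the correction. *)
pose b : {linear free B (ker h) -> free B V} :=
  free_lift (fun g => free_gen B (ker_val g) - free_gen B 0 : free B V).
have augb x : aug V (b x) = ker_val (free_lift idfun x : ker h).
  pose f1 : {linear free B (ker h) -> V} := aug V \o b.
  pose f2 : {linear free B (ker h) -> V} := @ker_val _ _ _ h \o free_lift idfun.
  suff: f1 x = f2 x by [].
  apply: free_linear_ext => g; rewrite /f1 /f2 /= !free_lift_gen linearB.
  by rewrite /= !free_lift_gen /= subr0.
have freeb x : free_map (b x) = 0.
  pose f1 : {linear free B (ker h) -> restr rho (free B' V')} := free_map \o b.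
  suff: f1 x = \0 x by [].
  apply: free_linear_ext => g; rewrite /f1 /= !free_lift_gen linearB /=.
  by rewrite !free_lift_gen ker_valP raddf0 subrr.
by exists (b \o s) => g; rewrite /= augb sK freeb.
Qed.

Variable k : {linear ker (aug V) -> restr rho (ker (aug V'))}.
Hypothesis kE : forall x, ker_val (k x : ker (aug V')) = free_map (ker_val x).

(** A preimage under [free_map] need not be a syzygy, but its augmentation lies in [ker h];
    subtracting the section of that augmentation makes it one and leaves its image unchanged. *)
Lemma syzygy_map_surj x' : exists x, k x = x'.
Proof.
have [y yE] := free_map_surj (ker_val (x' : ker (aug V'))).
have [|g gE] := @ker_val_surj _ _ _ h (aug V y).
  by rewrite -aug_free_map yE ker_valP.
have [s sE] := ker_section; have [augs frees] := sE g.
have [|x xE] := @ker_val_surj _ _ _ (aug V) (y - s g).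
  by rewrite linearB augs gE subrr.
by exists x; apply: ker_val_inj; rewrite kE xE linearB frees subr0.
Qed.

(* Subtracting the lift to [free V] of the projective [ker h] moves the      *)
(* kernel of [free V -> free V'] into that of [ker (aug V) -> ker (aug V')]. *)
Lemma ker_retraction :
  exists (s : {linear ker h -> free B V}) (a : {linear ker free_map -> ker h})
    (r : {linear ker free_map -> ker k}),
    [/\ forall x, ker_val (a x) = aug V (ker_val x)
      & forall x, ker_val (ker_val (r x)) = ker_val x - s (a x)].
Proof.
have [s sE] := ker_section.
have [|a aE] := @ker_lift B (ker free_map) V _ (aug V \o @ker_val _ _ _ _) h.
  by move=> x; rewrite /= -aug_free_map ker_valP raddf0.
have [|r1 r1E] := @ker_lift B (ker free_map) (free B V) V
    (@ker_val _ _ _ free_map \- (s \o a)) (aug V).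
  by move=> x; rewrite /= linearB /= (sE _).1 aE subrr.
have [|r rE] := @ker_lift B (ker free_map) (ker (aug V)) _ r1 k.
  move=> x; apply: ker_val_inj; rewrite kE r1E linearB ker_valP (sE _).2 subrr.
  by rewrite raddf0.
by exists s, a, r; split=> // x; rewrite rE r1E.
Qed.

Lemma ker_embedding : exists i : {linear ker k -> ker free_map},
  forall x, ker_val (i x) = ker_val (ker_val x).
Proof.
apply: (@ker_lift B (ker k) (free B V) _ (@ker_val _ _ _ (aug V) \o @ker_val _ _ _ k)).
by move=> x; rewrite /= -kE ker_valP raddf0.
Qed.

(* The first summand factors through [free V]; the second one has            *)
(* coefficients in the kernel of [rho], so it dies after tensoring with [P]. *)
Lemma ker_decomp : exists (f : {linear free B V -> ker free_map})
    (w : V' -> T -> ker free_map) (q : {linear free B V -> free B V'}),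
  forall x, (forall v', rho (q (ker_val x) v') = 0) /\
    x = f (ker_val x) + dual_sum w (q (ker_val x)).
Proof.
have [hsurj _ _] := h_adm; have [sig sigK] := choice hsurj.
(* [q] relabels basis vectors along [h], and [p] relabels them back along a set-theoretic section.
   The decomposition is x = (x - p q x) + p q x, where [q x] has coordinates in the kernel of [rho]
   as soon as [free_map] kills x. *)
pose q : {linear free B V -> free B V'} :=
  free_lift (fun v => free_gen B (h v : V') : free B V').
pose p : {linear free B V' -> free B V} :=
  free_lift (fun v' => free_gen B (sig v') : free B V).
have qE x : free_restr rho V' (q x) = free_map x.
  pose f : {linear free B V -> restr rho (free B' V')} := free_restr rho V' \o q.
  suff: f x = free_map x by [].
  by apply: free_linear_ext => v; rewrite /f /= !free_lift_gen.
have pE z : free_map (p z) = free_restr rho V' z.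
  pose f : {linear free B V' -> restr rho (free B' V')} := free_map \o p.
  suff: f z = free_restr rho V' z by [].
  by apply: free_linear_ext => v'; rewrite /f /= !free_lift_gen sigK.
have q0 (x : ker free_map) v' : rho (q (ker_val x) v') = 0.
  have qx : free_restr rho V' (q (ker_val x)) = 0 by rewrite qE ker_valP.
  by rewrite -free_restrE qx; apply: free0.
have [|f fE] := @ker_lift B (free B V) _ _ (idfun \- (p \o q)) free_map.
  by move=> x; rewrite /= linearB /= pE qE subrr.
have w_ex v' t : exists w : ker free_map,
    ker_val w = e t *: (free_gen B (sig v') : free B V).
  apply: ker_val_surj; rewrite linearZ /= restrZ rho_e.
  by rewrite [LHS](@scale0r B').
have {w_ex} /choice[w wE] : forall v', exists w : T -> ker free_map, forall t,
    ker_val (w t) = e t *: (free_gen B (sig v') : free B V).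
  by move=> v'; have [g gE] := choice (w_ex v'); exists g.
exists f, w, q => x; split=> //; apply: ker_val_inj.
rewrite linearD /= fE dual_sum_map /= -[LHS](subrK (p (q (ker_val x)))).
congr (_ + _); rewrite -[LHS](dual_sum_lift (fun v' => free_gen B (sig v')) (q0 x)).
by apply: eq_bigr => v' _; apply: eq_bigr => t _; rewrite wE.
Qed.

(** The retraction of [ker_retraction] is a left inverse of the embedding [i], its correction term
    [a] being zero on syzygies. It therefore carries the decomposition of [ker free_map] over to its
    summand [ker k]. *)
Lemma ker_syzygy_decomp : exists (i : {linear ker k -> ker free_map})
    (f : {linear free B V -> ker k}) (w : V' -> T -> ker k)
    (q : {linear free B V -> free B V'}),
  forall x, [/\ ker_val (i x) = ker_val (ker_val x),
    forall v', rho (q (ker_val (i x)) v') = 0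
    & x = f (ker_val (i x)) + dual_sum w (q (ker_val (i x)))].
Proof.
have [s [a [r [aE rE]]]] := ker_retraction.
have [i iE] := ker_embedding.
have [f [w [q fqE]]] := ker_decomp.
have riK x : r (i x) = x.
  do 2!apply: ker_val_inj; rewrite rE iE.
  have -> : a (i x) = 0 by apply: ker_val_inj; rewrite aE iE ker_valP raddf0.
  by rewrite raddf0 subr0.
exists i, (r \o f), (fun v' t => r (w v' t)), q => x.
split; [exact: iE | by case: (fqE (i x)) |].
by rewrite -[LHS]riK {1}(fqE (i x)).2 linearD dual_sum_map.
Qed.

Lemma ker_syzygy_projective : projective (ker k).
Proof.
have [i [f [w [q ifwq]]]] := ker_syzygy_decomp.
have q0 x v' : rho (q (ker_val (i x)) v') = 0 by case: (ifwq x).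
have xE x : x = f (ker_val (i x)) + dual_sum w (q (ker_val (i x))).
  by case: (ifwq x).
pose l : {linear free B V -> free B (ker k)} :=
  free_lift (fun v => free_gen B (f (free_gen B v)) : free B (ker k)).
have lE y : free_lift idfun (l y) = f y.
  pose f1 : {linear free B V -> ker k} := free_lift idfun \o l.
  suff: f1 y = f y by [].
  by apply: free_linear_ext => v; rewrite /f1 /= !free_lift_gen.
pose s1 x : free B (ker k) := l (ker_val (i x)) +
  dual_sum (fun v' t => free_gen B (w v' t) : free B (ker k)) (q (ker_val (i x))).
(* Linearity of the second summand depends on [q0], since [pi] is only linear on the kernel of
   [rho]. *)
have s1lin : linear s1.
  move=> b x y; rewrite /s1 !linearP /= dual_sumP; last exact: q0.
  by rewrite addrACA -[in LHS](@scalerDr B).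
pose s1L := GRing.isLinear.Build B _ (free B (ker k)) *:%R s1 s1lin.
pose s2 : {linear ker k -> free B (ker k)} := HB.pack s1 s1L.
exists s2 => x; rewrite [s2 x]/(s1 x) [RHS]xE -lE linearD dual_sum_map.
congr (_ + _); apply: eq_bigr => v' _; apply: eq_bigr => t _.
by rewrite /= free_lift_gen.
Qed.

(** [tensor_map P f] is a left inverse: the remaining summand of [ker_syzygy_decomp] dies by
    [tens_dual_sum]. This is stronger than admissibility of [k] requires, and [tensor_ker_iso] needs
    this stronger form. *)
Lemma ker_syzygy_inj t :
  tensor_map P (@ker_val _ _ _ (aug V)) (tensor_map P (@ker_val _ _ _ k) t) = 0 ->
  t = 0.
Proof.
have [i [f [w [q ifwq]]]] := ker_syzygy_decomp => t0.
pose u : {linear ker k -> free B V} := @ker_val _ _ _ (aug V) \o @ker_val _ _ _ k.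
have fuE : (tensor_map P f \o tensor_map P u) t = t.
  move: {t0} t; apply: (tensor_linear_ext
    (f := tensor_map P f \o tensor_map P u) (g := idfun)) => p x.
  rewrite -[LHS]/(tensor_map P f (tensor_map P u (tens p x))) !tensor_mapE.
  have [iE q0 xE] := ifwq x.
  by rewrite [X in tens p X = _]/= -iE {2}xE tensDr tens_dual_sum // addr0.
have ut : tensor_map P u t = 0 by rewrite -t0; apply: tensor_map_comp.
by rewrite -[t]fuE -[LHS]/(tensor_map P f (tensor_map P u t)) ut raddf0.
Qed.

Lemma admissible_syzygy : admissible k.
Proof.
split; [exact: syzygy_map_surj | exact: ker_syzygy_projective |] => t t0.
by apply: ker_syzygy_inj; rewrite t0 raddf0.
Qed.

(** The two kernels are Tor_1 of [V] over [B] and of [V'] over [B']. The isomorphism is induced by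
    [c], the map of tensor products coming from [k]. *)
Lemma tensor_ker_iso :
  iso (ker (tensor_map P (@ker_val _ _ _ (aug V))))
      (ker (tensor_map P' (@ker_val _ _ _ (aug V')))).
Proof.
have [s [a [r [aE rE]]]] := ker_retraction.
have [_ _ h_inj] := h_adm; have k_surj := syzygy_map_surj.
have kZ b x : k (b *: x) = rho b *: (k x : ker (aug V')) by rewrite linearZ.
have fZ b x : free_map (b *: x) = rho b *: (free_map x : free B' V').
  by rewrite linearZ.
have [c cE] := @tensor_compare _ _ _ _ rho_ralg _ _ _ thetaD thetaZ _
  (ker (aug V')) k (linearD k) kZ.
have [c0 c0E] := @tensor_compare _ _ _ _ rho_ralg _ _ _ thetaD thetaZ _
  (free B' V') free_map (linearD free_map) fZ.
have c_surj := tensor_compare_surj theta_bij k_surj cE.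
have c_exact := tensor_compare_exact rho_ralg thetaD thetaZ (linearD k) kZ
  rho_surj theta_bij k_surj cE (@ker_val_surj _ _ _ k).
have c0_exact := tensor_compare_exact rho_ralg thetaD thetaZ (linearD free_map) fZ
  rho_surj theta_bij free_map_surj c0E (@ker_val_surj _ _ _ free_map).
set j := @ker_val _ _ _ (aug V); set j' := @ker_val _ _ _ (aug V').
have cj t : tensor_map P' j' (c t) = c0 (tensor_map P j t).
  move: t; apply: (tensor_linear_ext (f := tensor_map P' j' \o c)
    (g := c0 \o tensor_map P j)) => p x.
  rewrite -[LHS]/(tensor_map P' j' (c (tens p x))).
  rewrite -[RHS]/(c0 (tensor_map P j (tens p x))).
  by rewrite !tensor_mapE cE c0E tensor_mapE /= kE.
pose i : {linear ker k -> ker (aug V)} := @ker_val _ _ _ k.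
set m := @ker_val _ _ _ free_map.
have rE' z : tensor_map P j (tensor_map P i (tensor_map P r z)) =
    tensor_map P m z - tensor_map P s (tensor_map P a z).
  move: z; apply: (tensor_linear_ext
    (f := tensor_map P j \o (tensor_map P i \o tensor_map P r))
    (g := tensor_map P m \- (tensor_map P s \o tensor_map P a))) => p x.
  rewrite -[LHS]/(tensor_map P j (tensor_map P i (tensor_map P r (tens p x)))).
  rewrite -[RHS]/(tensor_map P m (tens p x) -
                  tensor_map P s (tensor_map P a (tens p x))).
  by rewrite !tensor_mapE [X in tens p X = _]rE tensDr tensNr.
have ci0 z : c (tensor_map P i z) = 0.
  move: z; apply: (tensor_linear_ext (f := c \o tensor_map P i) (g := \0)) => p x.
  rewrite -[LHS]/(c (tensor_map P i (tens p x))) tensor_mapE cE [X in tens _ X]ker_valP.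
  exact: tens0r.
have augj t : tensor_map P (aug V) (tensor_map P j t) = 0.
  move: t; apply: (tensor_linear_ext
    (f := tensor_map P (aug V) \o tensor_map P j) (g := \0)) => p x.
  rewrite -[LHS]/(tensor_map P (aug V) (tensor_map P j (tens p x))) !tensor_mapE.
  by rewrite [X in tens _ X]ker_valP tens0r.
apply: (ker_iso (c := c)) => [t jt|t jt /c_exact[u ut]|t' jt'].
- by rewrite cj jt raddf0.
(* Injectivity: t comes from u in P (x) [ker k], and u already dies in P (x) [free B V]. *)
- by rewrite -ut (ker_syzygy_inj (t := u)) ?raddf0 // ut.
have [t ct] := c_surj t'.
have [z zE] : exists z, tensor_map P m z = tensor_map P j t.
  by apply: c0_exact; rewrite -cj ct.
(* The third admissibility condition applies: in P (x) V the element becomes the augmentation of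
   [tensor_map P j t], which is zero. *)
have az : tensor_map P a z = 0.
  apply: h_inj.
  rewrite -(tensor_map_comp (h := aug V \o m)); last by move=> x; apply: esym (aE x).
  by rewrite (tensor_map_comp (f := aug V) (g := m)) // zE augj.
(* The correction has the same image as t under [j], because the term through [s] vanishes by [az],
   and [c] kills it. *)
exists (t - tensor_map P i (tensor_map P r z)).
  by rewrite linearB rE' az raddf0 subr0 zE subrr.
by rewrite linearB ct ci0 subr0.
Qed.

End Step.

Variables (N : lmodType B) (N' : lmodType B') (nu : {linear N -> restr rho N'}).
Hypothesis nu_bij : bijective nu.

Lemma admissible_syzygies n :
  exists h : {linear syzygy N n -> restr rho (syzygy N' n)}, admissible h.
Proof.
elim: n => [|n [h h_adm]]; first by exists nu; apply: admissible_bij.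
have [k kE] := syzygy_map h.
exists k; exact (admissible_syzygy h_adm kE).
Qed.

Lemma tensor_bij_iso : iso (tensor P N) (tensor P' N').
Proof.
have [eta nuK etaK] := nu_bij.
have nuZ b x : nu (b *: x) = rho b *: (nu x : N') by rewrite linearZ.
have nu_surj v' : exists v, nu v = v' by exists (eta v').
have [c cE] := @tensor_compare _ _ _ _ rho_ralg _ _ _ thetaD thetaZ _ N' nu
  (linearD nu) nuZ.
(* As [nu] is injective, the zero map serves as presentation of its kernel. *)
have c_exact := tensor_compare_exact rho_ralg thetaD thetaZ (linearD nu) nuZ
  rho_surj theta_bij nu_surj cE (i := (\0 : {linear N -> N})).
apply: (iso_inj_surj (f := c)) => [t /c_exact[v v0|s <-]|].
- by exists 0; apply: (can_inj nuK); rewrite v0 raddf0.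
- move: s; apply: (tensor_linear_ext (g := \0)) => p x.
  by rewrite tensor_mapE tens0r.
exact (tensor_compare_surj theta_bij nu_surj cE).
Qed.

Theorem tor_dual_basis_iso n : iso (Tor P N n) (Tor P' N' n).
Proof.
case: n => [|n].
  apply: iso_trans (tor0_iso _ _) _.
  exact: iso_trans tensor_bij_iso (iso_sym (tor0_iso _ _)).
apply: iso_trans (torS_iso _ _ _) _; have [h h_adm] := admissible_syzygies n.
have [k kE] := syzygy_map h.
exact: iso_trans (tensor_ker_iso h_adm kE) (iso_sym (torS_iso _ _ _)).
Qed.

End DualBasis.

(** * From dual bases modulo [I] to quotient algebras *)

Section QuotientMap.
Variables (R : comPzRingType) (A : ralgType R) (I J : ideal A).
Hypothesis IJ : forall a, I a -> J a.

Definition qring_map of (forall a, I a -> J a) := fun q : qring I => rpi J (rrepr q).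

Lemma qring_mapE a : qring_map IJ (rpi I a) = rpi J a.
Proof. by apply/eq_qpi/IJ/rreprP. Qed.

Lemma qring_map_zmod : zmod_morphism (qring_map IJ).
Proof.
move=> p q; rewrite -(rreprK p) -(rreprK q) -(raddfB (rpi I)) !qring_mapE.
exact: (raddfB (rpi J)).
Qed.
Lemma qring_map_monoid : monoid_morphism (qring_map IJ).
Proof.
split=> [|p q]; first by rewrite -[1]/(rpi I 1) qring_mapE.
by rewrite -(rreprK p) -(rreprK q) -(rpiM I) !qring_mapE (rpiM J).
Qed.
HB.instance Definition _ :=
  GRing.isZmodMorphism.Build (qring I) (qring J) (qring_map IJ) qring_map_zmod.
HB.instance Definition _ :=
  GRing.isMonoidMorphism.Build (qring I) (qring J) (qring_map IJ) qring_map_monoid.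

Lemma qring_map_ralg r : qring_map IJ (ralg r) = ralg r.
Proof. exact: qring_mapE. Qed.

Lemma qring_map_surj q : exists p, qring_map IJ p = q.
Proof. by exists (rpi I (rrepr q)); rewrite qring_mapE rreprK. Qed.

Lemma qring_map_eq0 a : qring_map IJ (rpi I a) = 0 <-> J a.
Proof.
rewrite qring_mapE -[0](raddf0 (rpi J)) -[X in _ <-> J X]subr0.
exact: eq_qpi.
Qed.

Variables (T : finType) (e : T -> A) (pi : T -> A -> A).
Hypothesis eJ : forall t, J (e t).
Hypothesis piB : forall t, zmod_morphism (pi t).
Hypothesis piI : forall t a, I a -> I (pi t a).
Hypothesis piJ : forall t a, J a -> J (pi t a).
Hypothesis piM : forall t a x, J x -> I (pi t (a * x) - a * pi t x).
Hypothesis pi_e : forall x, J x -> I (x - \sum_t pi t x * e t).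

(** Both quotients act on the same underlying groups [P] and [N], so the comparison maps are
    identities, and [piI] lets [pi t] descend to A / I. *)
Theorem tor_quotient_iso (P : lmodType A^c) (N : lmodType A)
    (PI : killsr I P) (PJ : killsr J P) (NI : kills I N) (NJ : kills J N) n :
  iso (Tor (descendr PI) (descend NI) n) (Tor (descendr PJ) (descend NJ) n).
Proof.
pose rho : {rmorphism qring I -> qring J} := qring_map IJ.
pose pi1 t (q : qring I) : qring I := rpi I (pi t (rrepr q)).
have pi1E t a : pi1 t (rpi I a) = rpi I (pi t a).
  apply/eq_qpi; rewrite -piB; exact/piI/rreprP.
have pi1B t : zmod_morphism (pi1 t).
  move=> p q; rewrite -(rreprK p) -(rreprK q) -(raddfB (rpi I)) !pi1E piB.
  exact: (raddfB (rpi I)).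
pose pi2 t : {additive qring I -> qring I} :=
  HB.pack (pi1 t) (GRing.isZmodMorphism.Build (qring I) (qring I) (pi1 t) (pi1B t)).
have nuL : linear (id : descend NI -> restr rho (descend NJ)).
  move=> q x y; rewrite -(rreprK q); congr (_ + _).
  rewrite restrZ /rho /= qring_mapE.
  by rewrite [LHS]descend_scaleE [RHS]descend_scaleE.
pose nu : {linear descend NI -> restr rho (descend NJ)} :=
  HB.pack (id : descend NI -> restr rho (descend NJ))
    (GRing.isLinear.Build (qring I) (descend NI) (restr rho (descend NJ)) *:%R _ nuL).
apply: (@tor_dual_basis_iso R (qring I) (qring J) rho T (fun t => rpi I (e t)) pi2
  _ _ _ _ (descendr PI) (descendr PJ) id _ _ _ _ _ (descend NI) (descend NJ) nu).
- by move=> t; apply/qring_map_eq0.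
- move=> t q; rewrite -(rreprK q) [pi2 t _]pi1E => /qring_map_eq0 Jq.
  exact/qring_map_eq0/piJ.
- move=> t p q; rewrite -(rreprK p) -(rreprK q) -(rpiM I) => /qring_map_eq0 Jq.
  by rewrite ![pi2 t _]pi1E -(rpiM I); apply/eq_qpi/piM.
- move=> q; rewrite -(rreprK q) => /qring_map_eq0 Jq.
  have -> : \sum_t pi2 t (rpi I (rrepr q)) * rpi I (e t) =
      rpi I (\sum_t pi t (rrepr q) * e t).
    rewrite (raddf_sum (rpi I)); apply: eq_bigr => t _.
    by rewrite [pi2 t _]pi1E; apply: esym (rpiM I _ _).
  exact/eq_qpi/pi_e.
- exact: qring_map_ralg.
- exact: qring_map_surj.
- by [].
- move=> q p; rewrite -(rreprK q) /= qring_mapE.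
  by rewrite [LHS]descendr_scaleE [RHS]descendr_scaleE.
- by exists id.
- by exists id.
Qed.
End QuotientMap.

(** * Adding one cell at a time *)

Section Cellular.
Variables (R : comPzRingType) (A : ralgType R).
Variables (d : Order.disp_t) (L : porderType d) (D : cell_datum A L).
Local Notation M := (cellM D).
Local Notation C := (@cellC R A d L D _).
Local Notation cspan := (cell_span (@cellC R A d L D)).

Lemma cell_span_ind (X : set L) (Q : A -> Prop) :
  Q 0 -> (forall x y, Q x -> Q y -> Q (x + y)) ->
  (forall m r (S T : M m), X m -> Q (ralg r * C S T)) ->
  forall x, cspan X x -> Q x.
Proof.
move=> Q0 QD QC x [c cX ->]; rewrite /comb big_seq.
by elim/big_ind: _ => // -[m [S T]] /cX Xm; apply: QC.
Qed.

Lemma cell_coefMC l a (S T S' T' : M l) :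
  cell_coef D (a * C S T) (cell_ix S' T') = (T' == T)%:R * cell_r a S' S.
Proof.
have [->|T'T] := eqVneq T' T; first by rewrite mul1r cell_rE.
rewrite mul0r -(subrK (\sum_(S1 : M l) ralg (cell_r a S1 S) * C S1 T) (a * _)).
rewrite cell_coefD freeD cell_coef_low ?add0r; last exact: cell_rP.
rewrite cell_coef_sum free_sum_coef big1 // => S1 _.
by rewrite cell_coefZ freeZ cell_coefC (negPf T'T) andbF mulr0.
Qed.

(** Thus [C S T] acts on the cell module by C_U -> phi(C_T, C_U) C_S. The vanishing for other S' is
    the mirror image, under [cell_star], of the fact that left multiplication preserves the right
    index within a cell. *)
Lemma cell_rC l (S T U S' : M l) :
  cell_r (C S T) S' U = (S' == S)%:R * cell_form_basis T U.
Proof.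
rewrite -(cell_rE _ _ _ T); have [->|S'S] := eqVneq S' S.
  by rewrite mul1r cell_form_basisP.
rewrite -cell_coef_star cell_starM !cell_starC cell_coefMC (negPf S'S).
by rewrite !mul0r.
Qed.

Section Proj.
Variables (l : L) (t : M l).

(* The component of [a] in the left-module summand spanned by the [C S t].   *)
Definition cell_proj (a : A) : A :=
  \sum_(S : M l) ralg (cell_coef D a (cell_ix S t)) * C S t.

Lemma cell_projD a b : cell_proj (a + b) = cell_proj a + cell_proj b.
Proof.
rewrite -big_split; apply: eq_bigr => S _.
by rewrite cell_coefD freeD raddfD mulrDl.
Qed.

Lemma cell_projZ r a : cell_proj (ralg r * a) = ralg r * cell_proj a.
Proof.
rewrite mulr_sumr; apply: eq_bigr => S _.
by rewrite cell_coefZ freeZ rmorphM mulrA.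
Qed.

Lemma cell_projB : zmod_morphism cell_proj.
Proof.
move=> a b; rewrite cell_projD; congr (_ + _).
by rewrite -mulN1r -(rmorph1 (@ralg R A)) -rmorphN cell_projZ rmorphN rmorph1 mulN1r.
Qed.

Lemma cell_proj_span X a : X l -> cspan X (cell_proj a).
Proof. by move=> Xl; apply: cell_span_sum => S _; apply/cell_spanZ/cell_spanC. Qed.

Lemma cell_proj_notin X a : ~ X l -> cspan X a -> cell_proj a = 0.
Proof.
move=> nXl /cell_spanP Xa; apply: big1 => S _.
by rewrite fsfun_dflt ?rmorph0 ?mul0r //; apply/negP => /Xa.
Qed.

Lemma cell_projC (S T : M l) : cell_proj (C S T) = (t == T)%:R * C S t.
Proof.
rewrite /cell_proj (bigD1 S) //= big1 => [|S' S'S].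
  by rewrite addr0 cell_coefC eqxx rmorph_nat.
by rewrite cell_coefC (negPf S'S) rmorph0 mul0r.
Qed.
End Proj.

Section OneCell.
Variables (X Y : set L) (dX : down_closed X) (dY : down_closed Y) (l : L).
Hypothesis YX : Y `<=` X.
Hypothesis Xl : X l.
Hypothesis nYl : ~ Y l.
Hypothesis XYl : forall m, X m -> Y m \/ m = l.
Hypothesis hphi : forall q : M l,
  exists v : cell_module D l, cell_form (cell_basis q) v = 1.

Let lowY m : (m < l)%O -> Y m.
Proof.
move=> ml; have /XYl[//|ml'] : X m by apply: dX Xl; apply: ltW.
by rewrite ml' ltxx in ml.
Qed.

Let span_ind (Q : A -> Prop) :
  (forall y, cspan Y y -> Q y) -> (forall x y, Q x -> Q y -> Q (x + y)) ->
  (forall r x, Q x -> Q (ralg r * x)) -> (forall S T : M l, Q (C S T)) ->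
  forall x, cspan X x -> Q x.
Proof.
move=> QY QD QZ QC; apply: cell_span_ind => // [|m r S T /XYl[Ym|ml]].
- exact/QY/cell_span0.
- exact/QY/cell_spanZ/cell_spanC.
by apply: QZ; move: S T; rewrite ml; apply: QC.
Qed.

Lemma cell_proj_sum x : cspan X x -> cspan Y (x - \sum_(t : M l) cell_proj t x).
Proof.
move: x; apply: span_ind => [y Yy|x y Yx Yy|r x Yx|S T].
- by rewrite big1 ?subr0 // => t _; apply: cell_proj_notin Yy.
- under eq_bigr do rewrite cell_projD.
  by rewrite big_split opprD addrACA; apply: cell_spanD.
- under eq_bigr do rewrite cell_projZ.
  by rewrite -mulr_sumr -mulrBr; apply: cell_spanZ.
rewrite (bigD1 T) //= big1 => [|t tT]; rewrite cell_projC.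
  by rewrite eqxx mul1r addr0 subrr; apply: cell_span0.
by rewrite (negPf tT) mul0r.
Qed.

(** Left multiplication preserves the right index up to lower cells, and those belong to [Y] by
    [lowY]. *)
Lemma cell_projM (t : M l) a x :
  cspan X x -> cspan Y (cell_proj t (a * x) - a * cell_proj t x).
Proof.
move: x; apply: span_ind => [y Yy|x y Yx Yy|r x Yx|S T].
- have Yay : cspan Y (a * y) by apply: cell_spanMl.
  rewrite !(@cell_proj_notin l t Y) // mulr0 subr0; exact: cell_span0.
- by rewrite mulrDr !cell_projD mulrDr opprD addrACA; apply: cell_spanD.
- have ar z : a * (ralg r * z) = ralg r * (a * z) by rewrite mulrA -ralgC mulrA.
  by rewrite ar !cell_projZ ar -mulrBr; apply: cell_spanZ.
rewrite cell_projC; have [->|tT] := eqVneq t T; last first.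
  rewrite mul0r mulr0 subr0 /cell_proj big1 => [|S' _]; first exact: cell_span0.
  by rewrite cell_coefMC (negPf tT) mul0r rmorph0 mul0r.
rewrite mul1r /cell_proj; under eq_bigr do rewrite cell_rE.
rewrite -opprB -sub0r; apply: cell_spanB; first exact: cell_span0.
exact: cell_spanS lowY (cell_rP _ _ _).
Qed.

(** By [cell_proj_sum] it suffices that right multiplication by the element attached to t fixes each
    [C S t] modulo I_Y; this is where phi(C_t, v) = 1 enters. *)
Lemma cell_dual_basis (v : M l -> cell_module D l) x :
  (forall q, cell_form (cell_basis q) (v q) = 1) -> cspan X x ->
  cspan Y (x - \sum_(t : M l) cell_proj t x *
                 \sum_(U : M l) ralg (v t U) * C U t).
Proof.
move=> v1 Xx.
rewrite -(subrKA (\sum_(t : M l) cell_proj t x)) -sumrB.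
apply: cell_spanD; first exact: cell_proj_sum.
apply: cell_span_sum => t _; rewrite mulr_suml -sumrB.
apply: cell_span_sum => S _; rewrite -mulrA -mulrBr; apply: cell_spanZ.
(* The leading term of [C S t] times that element: by [cell_rC] only S' = S survives, and the
   coefficients add up to phi(C_t, [v t]) = 1. *)
have CE : \sum_(U : M l) ralg (v t U) *
    (\sum_(S' : M l) ralg (cell_r (C S t) S' U) * C S' t) = C S t.
  transitivity (ralg (cell_form (cell_basis t) (v t)) * C S t); last first.
    by rewrite v1 rmorph1 mul1r.
  rewrite /cell_form [in RHS](bigD1 t) //= [X in _ + X]big1 => [|T' T't]; last first.
    by rewrite big1 // => S' _; rewrite ffunE (negPf T't) !mul0r.
  rewrite addr0 rmorph_sum [in RHS]mulr_suml; apply: eq_bigr => U _.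
  rewrite (bigD1 S) //= [X in _ + X]big1 => [|S' S'S]; last first.
    by rewrite cell_rC (negPf S'S) mul0r rmorph0 mul0r.
  by rewrite addr0 cell_rC eqxx ffunE eqxx !mul1r rmorphM mulrA.
rewrite -[X in X - _]CE.
rewrite mulr_sumr -sumrB; apply: cell_span_sum => U _.
rewrite [C S t * _]mulrA -ralgC -mulrA -mulrBr; apply: cell_spanZ.
rewrite -opprB -sub0r; apply: cell_spanB; first exact: cell_span0.
exact: cell_spanS lowY (cell_rP _ _ _).
Qed.

Lemma tor_one_cell (P : lmodType A^c) (N : lmodType A)
    (PX : killsr (cell_ideal D dX) P) (PY : killsr (cell_ideal D dY) P)
    (NX : kills (cell_ideal D dX) N) (NY : kills (cell_ideal D dY) N) n :
  iso (Tor (descendr PY) (descend NY) n) (Tor (descendr PX) (descend NX) n).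
Proof.
have [v v1] := choice hphi.
apply: (@tor_quotient_iso R A (cell_ideal D dY) (cell_ideal D dX)
  (fun a => cell_spanS YX) (M l)
  (fun t => \sum_(U : M l) ralg (v t U) * C U t) (@cell_proj l)).
- by move=> t; apply: cell_span_sum => U _; apply/cell_spanZ/cell_spanC.
- exact: cell_projB.
- by move=> t a Ya; rewrite (@cell_proj_notin l t Y) //; apply: cell_span0.
- by move=> t a _; apply: cell_proj_span.
- exact: cell_projM.
- by move=> x; apply: cell_dual_basis.
Qed.

End OneCell.

Lemma exists_minimal (F : {fset L}) (a : L) : a \in F ->
  exists2 l, l \in F & forall m, m \in F -> ~~ (m < l)%O.
Proof.
(* Descent on the number of elements of [F] below [a]. *)
have [n] := ubnP #|` [fset m in F | (m < a)%O]%fset|.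
elim: n a => // n IH a /ltnSE Fn aF.
have [/existsP[[m mF] /= ma]|] := boolP [exists m : F, (val m < a)%O]; last first.
  by rewrite negb_exists => /forallP Fa; exists a => // m mF; apply: (Fa [` mF]%fset).
apply: (IH m) => //; apply: leq_trans Fn; apply: fproper_ltn_card.
rewrite fproperE; apply/andP; split.
  apply/fsubsetP => x; rewrite !inE /= => /andP[-> xm]; exact: lt_trans ma.
by apply/fsubsetPn; exists m; rewrite !inE /= mF ?ma // ltxx.
Qed.

Lemma tor_cells (X Y : set L) (dX : down_closed X) (dY : down_closed Y)
    (P : lmodType A^c) (N : lmodType A)
    (PX : killsr (cell_ideal D dX) P) (PY : killsr (cell_ideal D dY) P)
    (NX : kills (cell_ideal D dX) N) (NY : kills (cell_ideal D dY) N) n :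
  Y `<=` X -> finite_set (X `\` Y) ->
  (forall l, (X `\` Y) l -> forall q : M l,
     exists v : cell_module D l, cell_form (cell_basis q) v = 1) ->
  iso (Tor (descendr PY) (descend NY) n) (Tor (descendr PX) (descend NX) n).
Proof.
move=> YX /finite_fsetP[F FE]; have [k] := ubnP #|` F|%fset.
elim: k => // k IH in F Y dY PY NY YX FE * => /ltnSE Fk hphi.
have FP m : m \in F <-> X m /\ ~ Y m.
  by rewrite -[X m /\ _]/((X `\` Y) m) FE.
have [F0|[a aF]] := fset_0Vmem F.
  have XY : Y = X.
    apply/seteqP; split=> // m Xm; apply: contrapT => nYm.
    by have := (FP m).2 (conj Xm nYm); rewrite F0.
  move: dY PY NY {YX FE FP hphi}; rewrite XY => dY.
  (* Tor depends on the closure and annihilation proofs through its types, so these must be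
     identified as well. *)
  have -> : dY = dX by apply: Prop_irrelevance.
  move=> PY NY; have -> : PY = PX by apply: Prop_irrelevance.
  have -> : NY = NX by apply: Prop_irrelevance.
  exact: iso_refl.
have [l lF lmin] := exists_minimal aF; have [Xl nYl] := (FP l).1 lF.
pose Y' := [set m | Y m \/ m = l].
have Y'X : Y' `<=` X by move=> m [/YX|->].
(* Whatever lies strictly below l is in [X], and the minimality of l among the remaining cells puts
   it in [Y]. *)
have dY' : down_closed Y'.
  move=> m1 m m1m [Ym|ml]; first by left; exact (dY _ _ m1m Ym).
  move: m1m; rewrite ml le_eqVlt => /orP[/eqP|m1l]; first by right.
  left; apply: contrapT => nYm1; have /lmin := (FP m1).2 (conj (dX _ _ (ltW m1l) Xl) nYm1).
  by rewrite m1l.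
have PY' : killsr (cell_ideal D dY') P := cell_ideal_killsr dY' Y'X PX.
have NY' : kills (cell_ideal D dY') N := cell_ideal_kills dY' Y'X NX.
apply: iso_trans (IH (F `\ l)%fset Y' dY' PY' NY' Y'X _ _ _).
- apply: (@tor_one_cell Y' Y dY' dY l) => //.
  + by move=> m; left.
  + by right.
  + by apply: hphi; split.
- apply/seteqP; split=> m /=.
    move=> [Xm nY'm]; rewrite !inE; apply/andP; split.
      by apply/eqP => ml; apply: nY'm; right.
    by apply/FP; split=> // Ym; apply: nY'm; left.
  rewrite !inE => /andP[/eqP ml /FP[Xm nYm]]; split=> //.
  by case.
- by apply: leq_trans Fk; rewrite (cardfsD1 l F) lF.
- by move=> m [Xm nY'm]; apply: hphi; split=> // Ym; apply: nY'm; left.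
Qed.

End Cellular.

Theorem theorem1p4 (R : comPzRingType) (A : ralgType R)
    (d : Order.disp_t) (L : porderType d) (D : cell_datum A L)
    (X Y : set L) (dX : down_closed X) (dY : down_closed Y)
    (YX : Y `<=` X) (finXY : finite_set (X `\` Y))
    (hphi : forall l : L, (X `\` Y) l -> forall q : cellM D l,
       exists v : cell_module D l, cell_form (cell_basis q) v = 1)
    (P : lmodType A^c) (N : lmodType A)
    (PX : killsr (cell_ideal D dX) P) (NX : kills (cell_ideal D dX) N) :
  forall n : nat, exists f :
    {linear Tor (descendr (cell_ideal_killsr dY YX PX))
                (descend (cell_ideal_kills dY YX NX)) n ->
            Tor (descendr PX) (descend NX) n},
    bijective f.
Proof. by move=> n; apply: tor_cells. Qed.
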